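(* Let $s\in\mathbb{Z}_{\ge2}$ and let all graph patterns below have ambient multiplicity $a=2$ (so for a graph $H$, the pattern is $H^{(2)}$). Then: (i) for $2\binom{s}{2}\le q<\Sigma_{P_4}(s)$, $\mathrm{ex}_\Pi(s,q)=2$; (ii) for $\Sigma_{P_4}(s)\le q<\Sigma_{K_{1,3}}(s)$, $\mathrm{ex}_\Pi(s,q)=2\left(\frac{9}{8}\right)^{1/6}$; (iii) for $\Sigma_{K_{1,3}}(s)\le q<\Sigma_{K_{1,4}}(s)$, $\mathrm{ex}_\Pi(s,q)=2\left(\frac{27}{16}\right)^{1/10}$.
   Context: A multigraph $G=(V,w)$ is a finite vertex set with $w\colon\binom V2\to\mathbb{Z}_{\ge0}$; $e(X)=\sum_{uv\in\binom X2}w(uv)$, $P(G)=\prod_{uv\in\binom V2}w(uv)$. $G$ is an $(s,q)$-graph if $e(X)\le q$ for every $s$-set $X$. $\mathrm{ex}_\Pi(n,s,q)$ is the maximum of $P(G)$ over $(s,q)$-graphs on $[n]$, and $\mathrm{ex}_\Pi(s,q)=\lim_{n\to\infty}\mathrm{ex}_\Pi(n,s,q)^{1/\binom n2}$ (the limit exists). A pattern $P$ on a finite set $V(P)$ assigns non-negative integer multiplicities to vertices (loops) and pairs; a blow-up of $P$ on $[s]$ is a multigraph on $[s]$ with a map $f\colon[s]\to V(P)$ (not necessarily surjective) such that $w(vv')=P(\{f(v),f(v')\})$ for distinct $v,v'$ (a loop multiplicity if $f(v)=f(v')$); $\Sigma_P(s)$ is the maximum of $e(G)=e(V(G))$ over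 blow-ups $G$ of $P$ on $[s]$. For a graph $H$ and $a\ge1$, $H^{(a)}$ is the pattern on $V(H)$ with loops of multiplicity $a-1$, non-adjacent pairs of multiplicity $a$, edges of multiplicity $a+1$. $K_{1,\ell}$ is the star with $\ell$ leaves and $P_4$ the path on 4 vertices. *)

(* Defs.v *)
From mathcomp Require Import all_boot all_order all_algebra.
From mathcomp Require Import all_classical all_reals all_analysis.

Set Implicit Arguments.
Unset Strict Implicit.
Unset Printing Implicit Defensive.
Import Order.TTheory GRing.Theory Num.Theory.
Import numFieldNormedType.Exports.

Local Open Scope ring_scope.

(* A weight w : {set V} -> nat on all subsets of V; only its values on the
   2-subsets of V are ever used, so this is a map from pairs to nat. *)
Definition multigraph (V : finType) := {set V} -> nat.

Definition mg_sum (V : finType) (w : multigraph V) (X : {set V}) : nat :=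
  (\sum_(A : {set V} | (A \subset X) && (#|A| == 2)) w A)%N.

Definition mg_prod (V : finType) (w : multigraph V) : nat :=
  (\prod_(A : {set V} | #|A| == 2) w A)%N.

Definition sq_graph (V : finType) (s q : nat) (w : multigraph V) : Prop :=
  forall X : {set V}, #|X| = s -> (mg_sum w X <= q)%N.

(* The set of products is nonempty, and finite when n >= s >= 2 (every weight
   is then at most q), so there the supremum is a maximum.  For n < s no
   maximum need exist; those n do not affect the limit in n. *)
Definition exPi_n (R : realType) (n s q : nat) : R :=
  sup [set (mg_prod w)%:R | w in [set w : multigraph 'I_n | sq_graph s q w]]%classic.

(* The sequence whose limit is ex_Pi(s, q). *)
Definition exPi_root (R : realType) (s q : nat) : nat -> R :=
  fun n => exPi_n R n s q `^ (('C(n, 2))%:R)^-1.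

(* Only the values on singletons (loops) and on 2-subsets are used. *)
Definition pattern (T : finType) := {set T} -> nat.

(* On a pair A = {v, v'}, f @: A is {f v, f v'}, a singleton if f v = f v'. *)
Definition blow_up (T : finType) (P : pattern T) (s : nat)
    (f : {ffun 'I_s -> T}) : multigraph 'I_s :=
  fun A => P (f @: A)%SET.

Definition Sigma (T : finType) (P : pattern T) (s : nat) : nat :=
  (\max_(f : {ffun 'I_s -> T}) mg_sum (blow_up P f) [set: 'I_s]%SET)%N.

(* E is the edge set of a simple graph on T. *)
Definition graph_pattern (T : finType) (E : {set {set T}}) (a : nat) :
    pattern T :=
  fun A => if #|A| == 1%N then a.-1 else if A \in E then a.+1 else a.

Definition star (l : nat) : {set {set 'I_l.+1}} :=
  [set [set ord0; i] | i : 'I_l.+1 & i != ord0]%SET.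

Definition path4 : {set {set 'I_4}} :=
  [set A : {set 'I_4} |
    [exists i : 'I_4, exists j : 'I_4,
       (A == [set i; j]) && (nat_of_ord j == i.+1)]]%SET.

(* Main.v *)
(* Lower bounds: a pair of colours from the 2-subsets of {0,..,4} gets weight
   3 - |c /\ c'|; this is the pattern of the Petersen graph, loops included, and
   the six colours {i,3}, {i,4} (i < 3) induce a hexagon.  If T_k counts the
   vertices whose colour contains k then e(X) = 3 C(s,2) - sum_k C(T_k,2), which
   convexity bounds by Sigma of K_{1,3}, resp. of P_4.  Averaging over the colour
   of the next vertex yields a colouring with product at least rho^C(n,2).

   Upper bounds: by a cloning (supersaturation) argument almost every map
   Phi : [m] -> [n] pulls an (s,q)-graph back to a multigraph W on [m] all of
   whose s-vertex blow-ups with loops of weight 1 have sum at most q.  Averaging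
   over Phi reduces the problem to bounding sum ln W up to O(m).  Zykov
   symmetrisation along pairs of weight 1 leaves weights x on a set where W takes
   the values 2 and 3 only; the graph A of the pairs of weight 3 has maximum
   degree at most 3 (2 in (i), (ii)), no triangle and no C_4 (no C_5 in (ii), no
   P_4 in (i)), because those patterns have too large a Sigma.  A Moore-bound
   argument at a vertex of maximum weight gives x'Ax - x'x <= S^2/5 (S^2/6 in
   (ii)) with S = sum x, and x'Ax <= 3 x'x (2 x'x); the bound on
   ln(3/2) x'Ax - ln 2 x'x is a combination of the two with nonnegative
   coefficients. *)
Require Import Defs.
From mathcomp Require Import all_boot all_order all_algebra.
From mathcomp Require Import all_classical all_reals all_analysis.
From mathcomp Require Import perm zify ring lra.
Import Order.TTheory GRing.Theory Num.Theory.
Import numFieldNormedType.Exports.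

Set Implicit Arguments.
Unset Strict Implicit.
Unset Printing Implicit Defensive.

(** * Patterns and their Sigma *)

(** The diagonal value 1 is the loop multiplicity [a - 1] for [a = 2], so pulling [wt w] back along
    any map joins clones by weight 1. As ln 1 = 0, the diagonal disappears from sums of
    logarithms. *)
Definition wt (V : finType) (w : multigraph V) (i j : V) : nat :=
  if i == j then 1 else w [set i; j]%SET.

Lemma wtii (V : finType) (w : multigraph V) i : wt w i i = 1.
Proof. by rewrite /wt eqxx. Qed.

Lemma wtC (V : finType) (w : multigraph V) i j : wt w i j = wt w j i.
Proof. by rewrite /wt eq_sym finset.setUC. Qed.

Lemma big_pairs (T : Type) (idx : T) (op : Monoid.com_law idx) (V : finType)
    (g : {set V} -> T) (X : {set V}) :
  \big[op/idx]_(i in X) \big[op/idx]_(j in X | j != i) g [set i; j]%SET =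
  op (\big[op/idx]_(A : {set V} | (A \subset X) && (#|A| == 2)) g A)
     (\big[op/idx]_(A : {set V} | (A \subset X) && (#|A| == 2)) g A).
Proof.
rewrite pair_big_dep /= -big_split /=.
rewrite (partition_big (fun p : V * V => [set p.1; p.2]%SET)
  (fun A : {set V} => (A \subset X) && (#|A| == 2))) /=; last first.
  move=> [i j] /= /and3P[iX jX ji].
  by rewrite cards2 (eq_sym i j) ji finset.subUset !finset.sub1set iX jX.
apply: eq_bigr => A /andP[AX /cards2P[x [y [xy EA]]]]; subst A.
move: AX; rewrite finset.subUset !finset.sub1set => /andP[xX yX].
rewrite (bigD1 (x, y)) /=; last by rewrite xX yX eq_sym xy eqxx.
rewrite (bigD1 (y, x)) /=; last first.
  by rewrite xX yX xy finset.setUC eqxx /= xpair_eqE negb_and xy orbT.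
rewrite big1 ?Monoid.mulm1.
  by rewrite [in X in op _ X]finset.setUC.
move=> [i j] /= /andP[/andP[/andP[/and3P[iX jX ji] /eqP E] n1] n2].
have: i \in [set x; y]%SET by rewrite -E !inE eqxx.
have: j \in [set x; y]%SET by rewrite -E !inE eqxx orbT.
move: ji n1 n2; rewrite !inE !xpair_eqE => ji n1 n2.
by case/orP=> /eqP ?; case/orP=> /eqP ?; subst; rewrite !eqxx in ji n1 n2.
Qed.

(** This symmetric form over ordered pairs replaces e(X) throughout; the diagonal adds [#|X|], so
    e(X) <= q on s-sets becomes a bound by [2 * q + s]. *)
Lemma mg_sum_wt (V : finType) (w : multigraph V) (X : {set V}) :
  2 * mg_sum w X + #|X| = \sum_(i in X) \sum_(j in X) wt w i j.
Proof.
rewrite mul2n -addnn /mg_sum -(big_pairs _ w) -sum1_card -big_split /=.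
apply: eq_bigr => i iX; rewrite [RHS](bigD1 i) //= wtii addnC; congr (_ + _).
by apply: eq_bigr => j /andP[_ ji]; rewrite /wt eq_sym (negPf ji).
Qed.

Section Patterns.
Variables (T : finType) (E : {set {set T}}).
Notation P := (graph_pattern E 2).

Lemma graph_pattern1 i : P [set i; i]%SET = 1.
Proof. by rewrite /graph_pattern finset.setUid cards1. Qed.

Lemma mg_sum_blow_up s (f : {ffun 'I_s -> T}) :
  2 * mg_sum (blow_up P f) [set: 'I_s]%SET + s =
  \sum_a \sum_b P [set f a; f b]%SET.
Proof.
have := mg_sum_wt (blow_up P f) [set: 'I_s]%SET; rewrite cardsT card_ord => ->.
rewrite (eq_bigl xpredT) => [|i]; last by rewrite !inE.
apply: eq_bigr => a _.
rewrite (eq_bigl xpredT) => [|i]; last by rewrite !inE.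
apply: eq_bigr => b _; rewrite /wt; case: eqP => [->|ab].
  by rewrite graph_pattern1.
by rewrite /blow_up imsetU1 imset_set1.
Qed.

(** A list stands for a map from its positions; concatenated [nseq] blocks prescribe the fibre sizes
    of a blow-up. *)
Lemma Sigma_ge_seq s (l : seq T) : size l = s ->
  \sum_(x <- l) \sum_(y <- l) P [set x; y]%SET <= 2 * Sigma P s + s.
Proof.
case: l => [<-|x0 l0]; first by rewrite big_nil.
set l := x0 :: l0 => sl.
pose f := [ffun a : 'I_s => nth x0 l a].
have := leq_bigmax (F := fun f => mg_sum (blow_up P f) [set: 'I_s]%SET) f.
rewrite -/(Sigma P s) => le.
apply: (@leq_trans (2 * mg_sum (blow_up P f) [set: 'I_s]%SET + s)); last first.
  by rewrite leq_add2r leq_mul2l le orbT.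
rewrite mg_sum_blow_up (big_nth x0) big_mkord sl; apply: leq_sum => a _.
rewrite (big_nth x0) big_mkord sl; apply: leq_sum => b _.
by rewrite !ffunE.
Qed.

Lemma Sigma_le s q : 
  (forall f : 'I_s -> T, \sum_a \sum_b P [set f a; f b]%SET <= 2 * q + s) ->
  Sigma P s <= q.
Proof.
move=> h; apply/bigmax_leqP => f _; have := h f.
by rewrite -mg_sum_blow_up leq_add2r leq_mul2l.
Qed.

Lemma Sigma_attained s : 0 < #|T| -> exists f : 'I_s -> T,
  2 * Sigma P s + s = \sum_a \sum_b P [set f a; f b]%SET.
Proof.
case/card_gt0P => t _.
have [|f Ef] := @bigop.eq_bigmax {ffun 'I_s -> T}
   (fun f => mg_sum (blow_up P f) [set: 'I_s]%SET).
  by apply/card_gt0P; exists [ffun _ => t].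
by exists f; rewrite /Sigma Ef mg_sum_blow_up.
Qed.

End Patterns.

Lemma star_patternE l (i j : 'I_l.+1) :
  graph_pattern (star l) 2 [set i; j]%SET =
  if i == j :> nat then 1 else if (i == 0 :> nat) || (j == 0 :> nat) then 3 else 2.
Proof.
rewrite -[0]/(val (@ord0 l)) !val_eqE.
case: eqP => [->|/eqP ij]; first by rewrite graph_pattern1.
rewrite /graph_pattern cards2 ij /=; congr (if _ then _ else _).
apply/imsetP/orP => [[k]|[/eqP|/eqP] ?]; last 2 first.
- by subst i; exists j; rewrite // inE eq_sym.
- by subst j; exists i; [rewrite inE|exact: finset.setUC].
rewrite inE => k0 E.
have : ord0 \in [set i; j]%SET by rewrite E !inE eqxx.
by rewrite !inE => /orP[] /eqP <-; [left|right].
Qed.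

Lemma path4_patternE (i j : 'I_4) :
  graph_pattern path4 2 [set i; j]%SET =
  if i == j :> nat then 1 else if (i.+1 == j :> nat) || (j.+1 == i :> nat) then 3 else 2.
Proof.
rewrite val_eqE; case: eqP => [->|/eqP ij]; first by rewrite graph_pattern1.
rewrite /graph_pattern cards2 ij /=; congr (if _ then _ else _).
rewrite inE; apply/existsP/orP => [[x /existsP[y /andP[/eqP E /eqP xy]]]|].
  have: i \in [set x; y]%SET by rewrite -E !inE eqxx.
  have: j \in [set x; y]%SET by rewrite -E !inE eqxx orbT.
  rewrite !inE => /orP[] /eqP jj /orP[] /eqP ii; subst i j;
    rewrite ?eqxx // xy in ij *; by [left|right].
case=> /eqP h.
  by exists i; apply/existsP; exists j; rewrite eqxx h eqxx.
by exists j; apply/existsP; exists i; rewrite finset.setUC eqxx h eqxx.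
Qed.

Lemma sum_fibers s k (f : 'I_s -> 'I_k) (h : nat -> nat) :
  \sum_a h (f a) = \sum_(i < k) #|[pred a | f a == i :> nat]| * h i.
Proof.
rewrite (partition_big f xpredT) //=; apply: eq_bigr => i _.
rewrite -sum1_card big_distrl /=; apply: eq_big => [a|a /eqP ->].
  by rewrite inE val_eqE.
by rewrite mul1n.
Qed.

Lemma pattern_form_fibers s k (f : 'I_s -> 'I_k) (g : nat -> nat -> nat) :
  exists c : nat -> nat, s = \sum_(i < k) c i /\
  \sum_a \sum_b g (f a) (f b) = \sum_(i < k) c i * \sum_(j < k) c j * g i j.
Proof.
exists (fun i => #|[pred a | f a == i :> nat]|); split.
  rewrite -[LHS]card_ord -sum1_card (sum_fibers f (fun=> 1)).
  by apply: eq_bigr => i _; rewrite muln1.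
rewrite -(sum_fibers f (fun i => \sum_(j < k) #|[pred a | f a == j :> nat]| * g i j)).
by apply: eq_bigr => a _; rewrite (sum_fibers f (g (f a))).
Qed.

Lemma double_mul_le a b : 2 * (a * b) <= a * a + b * b.
Proof. by have := (nat_Cauchy a b).1; rewrite -!mulnn. Qed.

(** With centre [x] and Y the sum of the leaves, convexity over the leaves bounds the form by x^2 +
    6xY + (7/4)Y^2, and four times the gap to (9/4)(x + Y)^2 is (x - Y)^2 + (2x - Y)^2. The constant
    is not optimal: 9/4 is the density of the balanced C_4 of weight-3 pairs, which is to be
    excluded. *)
Lemma Sigma_star4_le s :
  4 * (2 * Sigma (graph_pattern (star 4) 2) s + s) <= 9 * (s * s).
Proof.
have [|f ->] := @Sigma_attained _ (star 4) s; first by rewrite card_ord.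
under eq_bigr do under eq_bigr do rewrite star_patternE.
have [c [es ->]] := pattern_form_fibers f
  (fun i j => if i == j then 1 else if (i == 0) || (j == 0) then 3 else 2).
rewrite es !big_ord_recr !big_ord0 /= => {es}.
move: (c 0) (c 1) (c 2) (c 3) (c 4) => x y z t u.
have h1 := double_mul_le x (y + z + t + u).
have h2 := double_mul_le (2 * x) (y + z + t + u).
have := (double_mul_le y z, double_mul_le y t, double_mul_le y u,
  double_mul_le z t, double_mul_le z u, double_mul_le t u).
by move=> [] [] [] [] [] *; lia.
Qed.

(** The squares used, of 3x - 2(y + z + t) and of the differences of leaves, all vanish at the ratio
    2 : 1 : 1 : 1. *)
Lemma Sigma_star3_le s :
  5 * (2 * Sigma (graph_pattern (star 3) 2) s + s) <= 11 * (s * s).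
Proof.
have [|f ->] := @Sigma_attained _ (star 3) s; first by rewrite card_ord.
under eq_bigr do under eq_bigr do rewrite star_patternE.
have [c [es ->]] := pattern_form_fibers f
  (fun i j => if i == j then 1 else if (i == 0) || (j == 0) then 3 else 2).
rewrite es !big_ord_recr !big_ord0 /= => {es}.
move: (c 0) (c 1) (c 2) (c 3) => x y z t.
have h1 := double_mul_le (3 * x) (2 * (y + z + t)).
have := (double_mul_le y z, double_mul_le y t, double_mul_le z t).
by move=> [] [] *; lia.
Qed.

(** The four squares used all vanish at weights in the ratio 1 : 2 : 2 : 1. *)
Lemma Sigma_path4_le s :
  6 * (2 * Sigma (graph_pattern path4 2) s + s) <= 13 * (s * s).
Proof.
have [|f ->] := @Sigma_attained _ path4 s; first by rewrite card_ord.
under eq_bigr do under eq_bigr do rewrite path4_patternE.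
have [c [es ->]] := pattern_form_fibers f
  (fun i j => if i == j then 1 else if (i.+1 == j) || (j.+1 == i) then 3 else 2).
rewrite es !big_ord_recr !big_ord0 /= => {es}.
move: (c 0) (c 1) (c 2) (c 3) => x y z t.
have h1 := double_mul_le (x + z) (y + t).
have := (double_mul_le (x + t) y, double_mul_le (x + t) z, double_mul_le y z).
by move=> [] [] *; lia.
Qed.

Lemma sum_nseq_nat (T : Type) (x : T) n (h : T -> nat) :
  \sum_(i <- nseq n x) h i = n * h x.
Proof. by rewrite big_nseq iter_addn_0 mulnC. Qed.

(* The weights 2k, k, k, k are optimal for K_{1,3}.  As 9 < 10, this bound and
   [Sigma_star3_le] determine Sigma; likewise for P_4 below, as 11 < 12. *)
Lemma Sigma_star3_ge s :
  11 * (s * s) <= 5 * (2 * Sigma (graph_pattern (star 3) 2) s + s) + 9.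
Proof.
have key (c x y z : nat) : c + x + y + z = s ->
    2 * (s * s) + 2 * (c * (x + y + z)) <=
      2 * Sigma (graph_pattern (star 3) 2) s + s + c * c + x * x + y * y + z * z.
  move=> e.
  pose o k : 'I_4 := inord k.
  have := @Sigma_ge_seq _ (star 3) s
    (nseq c (o 0) ++ nseq x (o 1) ++ nseq y (o 2) ++ nseq z (o 3)).
  rewrite !size_cat !size_nseq !addnA => /(_ e).
  rewrite !(big_cat, sum_nseq_nat) /= !star_patternE /o !inordK //=.
  by rewrite -e; lia.
have := divn_eq s 5; have : s %% 5 < 5 by rewrite ltn_mod.
move: (s %/ 5) (s %% 5) => k [|[|[|[|[|//]]]]] _ e.
- by have := key (2 * k) k k k; rewrite e => /(_ _); lia.
- by have := key (2 * k) k.+1 k k; lia.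
- by have := key (2 * k).+1 k.+1 k k; lia.
- by have := key (2 * k).+1 k.+1 k.+1 k; lia.
- by have := key (2 * k).+2 k.+1 k.+1 k; lia.
Qed.

Lemma Sigma_path4_ge s :
  13 * (s * s) <= 6 * (2 * Sigma (graph_pattern path4 2) s + s) + 11.
Proof.
have key (c x y z : nat) : c + x + y + z = s ->
    2 * (s * s) + 2 * (c * x + x * y + y * z) <=
      2 * Sigma (graph_pattern path4 2) s + s + c * c + x * x + y * y + z * z.
  move=> e.
  pose o k : 'I_4 := inord k.
  have := @Sigma_ge_seq _ path4 s
    (nseq c (o 0) ++ nseq x (o 1) ++ nseq y (o 2) ++ nseq z (o 3)).
  rewrite !size_cat !size_nseq !addnA => /(_ e).
  rewrite !(big_cat, sum_nseq_nat) /= !path4_patternE /o !inordK //=.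
  by rewrite -e; lia.
have := divn_eq s 6; have : s %% 6 < 6 by rewrite ltn_mod.
move: (s %/ 6) (s %% 6) => k [|[|[|[|[|[|//]]]]]] _ e.
- by have := key k (2 * k) (2 * k) k; lia.
- by have := key k (2 * k).+1 (2 * k) k; lia.
- by have := key k (2 * k).+1 (2 * k).+1 k; lia.
- by have := key k (2 * k).+1 (2 * k).+1 k.+1; lia.
- by have := key k.+1 (2 * k).+1 (2 * k).+1 k.+1; lia.
- by have := key k.+1 (2 * k).+2 (2 * k).+1 k.+1; lia.
Qed.

(** * Quadratic forms on graphs of large girth *)

Section WeightedGraph.
Variables (J : finType) (A : rel J).
Hypotheses (Asym : symmetric A) (Airr : irreflexive A).

Definition adj_sum (x : J -> nat) (i : J) : nat := \sum_j A i j * x j.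
Definition adj_form (x : J -> nat) : nat := \sum_i x i * adj_sum x i.
Definition sq_form (x : J -> nat) : nat := \sum_i x i * x i.
Definition total_weight (x : J -> nat) : nat := \sum_i x i.

Lemma adj_form_deg d x : (forall i, #|[pred j | A i j]| <= d) ->
  adj_form x <= d * sq_form x.
Proof.
move=> deg.
have h : 2 * adj_form x <= \sum_i \sum_j (A i j * (x i * x i) + A i j * (x j * x j)).
  rewrite /adj_form big_distrr /=; apply: leq_sum => i _.
  rewrite /adj_sum !big_distrr /=; apply: leq_sum => j _.
  case: (A i j); last by rewrite !mul0n !muln0.
  by have := (nat_Cauchy (x i) (x j)).1; rewrite !mul1n -!mulnn.
have e : \sum_i \sum_j A i j * (x i * x i) <= d * sq_form x.
  rewrite /sq_form big_distrr /=; apply: leq_sum => i _.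
  rewrite -big_distrl /= leq_mul2r; apply/orP; right.
  rewrite (leq_trans _ (deg i)) // -sum1_card [leqRHS]big_mkcond /=.
  by apply: leq_sum => j _; rewrite inE; case: (A i j).
rewrite -(leq_pmul2l (isT : 0 < 2)) (leq_trans h) //.
under eq_bigr do rewrite big_split /=.
rewrite big_split /= [X in _ + X]exchange_big /=.
have -> : \sum_j \sum_i A i j * (x j * x j) = \sum_i \sum_j A i j * (x i * x i).
  by apply: eq_bigr => j _; apply: eq_bigr => i _; rewrite Asym.
lia.
Qed.

(* Removing one unit of weight at j lowers x'Ax - x'x by 2((Ax)_j - x_j) + 1. *)
Lemma adj_form_peel c : 0 < c ->
  (forall x : J -> nat, 0 < total_weight x ->
     exists2 j, 0 < x j & c * adj_sum x j <= total_weight x + c * x j) ->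
  forall x : J -> nat,
    c * adj_form x <=
      total_weight x * total_weight x + 2 * c * total_weight x + c * sq_form x.
Proof.
move=> c0 step x; have [k] := ubnP (total_weight x).
elim: k x => // k IH x lek.
have [x0|x0] := posnP (total_weight x).
  suff -> : adj_form x = 0 by rewrite muln0.
  apply: big1 => i _; move/eqP: x0; rewrite sum_nat_eq0 => /forallP /(_ i) /eqP.
  by move=> ->.
have [j xj le] := step x x0.
pose y i := x i - (i == j).
have yj : x j = (y j).+1 by rewrite /y eqxx subn1 prednK.
have yn i : i != j -> y i = x i by move=> /negPf ij; rewrite /y ij subn0.
have S : total_weight x = (total_weight y).+1.
  rewrite /total_weight (bigD1 j) //= yj [in RHS](bigD1 j) //= addSn; congr (_ + _).+1.
  by apply: eq_bigr => i /yn.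
have Q : sq_form x = sq_form y + 2 * y j + 1.
  rewrite /sq_form (bigD1 j) //= yj [in RHS](bigD1 j) //=.
  rewrite (eq_bigr (fun i => y i * y i)) => [|i /yn -> //]; lia.
have aj i : adj_sum x i = adj_sum y i + A i j.
  rewrite /adj_sum (bigD1 j) //= yj [in RHS](bigD1 j) //=.
  rewrite (eq_bigr (fun k => A i k * y k)) => [|i' /yn -> //]; lia.
have F : adj_form x = adj_form y + 2 * adj_sum y j.
  rewrite /adj_form (eq_bigr (fun i => x i * adj_sum y i + x i * A i j)).
    rewrite big_split /=.
    have -> : \sum_i x i * A i j = adj_sum y j.
      rewrite /adj_sum; apply: eq_bigr => i _; rewrite Asym mulnC.
      by have [->|/yn -> //] := eqVneq i j; rewrite Airr.
    rewrite (bigD1 j) //= yj [in RHS](bigD1 j) //=.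
    rewrite (eq_bigr (fun i => y i * adj_sum y i)) => [|i /yn -> //]; lia.
  by move=> i _; rewrite aj mulnDr.
(* After substituting the induction hypothesis and the choice of [j], the two sides differ by c - 1,
   nonnegative since [0 < c]. *)
have := IH y; rewrite -ltnS -S => /(_ lek).
move: le; rewrite aj Airr addn0 S Q F yj.
move: (total_weight y) (sq_form y) (adj_form y) (adj_sum y j) (y j) => S' Q' F' a b.
nia.
Qed.

Lemma sum_pred_le1 (P : pred J) : (forall u v, P u -> P v -> u = v) ->
  \sum_u P u <= 1.
Proof.
move=> uniqP; have [u Pu|no] := pickP P; last by rewrite big1 // => u _; rewrite no.
rewrite (bigD1 u) //= Pu big1 // => v vu.
by case Pv : (P v) => //; rewrite (uniqP _ _ Pu Pv) eqxx in vu.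
Qed.

Lemma exists_max_weight (x : J -> nat) : 0 < total_weight x ->
  exists2 v, 0 < x v & forall u, x u <= x v.
Proof.
move=> x0.
have [u0 u0P] : exists u0, 0 < x u0.
  apply/existsP; rewrite -[X in is_true X]negbK negb_exists; apply/negP => /forallP h.
  move: x0; rewrite /total_weight big1 // => i _; apply/eqP.
  by rewrite -leqn0 leqNgt; exact: h.
have [v _ vmax] := @arg_maxnP _ u0 xpredT x isT.
by exists v => [|u]; [apply: leq_trans u0P (vmax _ _)|apply: vmax].
Qed.

(** Moore-bound argument: if no vertex of positive weight can be peeled, all have neighbourhoods
    heavier than S/5 plus their own weight. Summed over the neighbours of a vertex of maximum
    weight, these are too heavy for the second neighbours, which girth 5 keeps distinct, to fit into
    S. The Petersen graph attains 1/5 = (3 - 1)/10. *)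
Lemma adj_form_girth5 :
  (forall i, #|[pred j | A i j]| <= 3) ->
  (forall a b c, A a b -> A b c -> A c a -> False) ->
  (forall a b c d, a != c -> A a b -> A b c -> A a d -> A d c -> b = d) ->
  forall x, 5 * adj_form x <=
    total_weight x * total_weight x + 10 * total_weight x + 5 * sq_form x.
Proof.
move=> deg noC3 noC4; apply: (@adj_form_peel 5) => // x x0.
have [v xv vmax] := exists_max_weight x0.
have [j /andP[h1 h2]|no] := pickP [pred j |
    (0 < x j) && (5 * adj_sum x j <= total_weight x + 5 * x j)].
  by exists j.
have {}no j : 0 < x j -> total_weight x + 5 * x j < 5 * adj_sum x j.
  by move=> xj; have := no j; rewrite /= xj /= ltnNge => ->.
exfalso.
pose D u := A v u && (0 < x u).
pose d := \sum_u D u.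
have d3 : d <= 3.
  apply: leq_trans (deg v); rewrite /d -sum1_card big_mkcond /=.
  rewrite [leqRHS]big_mkcond /=.
  by apply: leq_sum => u _; rewrite /D inE; case: (A v u) => //; case: (0 < x u).
have Nd : adj_sum x v <= d * x v.
  rewrite /d big_distrl; apply: leq_sum => u _; rewrite /D.
  case: (A v u) => //=; have := vmax u; case: (x u) => [|?]; rewrite ?mul1n //.
(* The closed neighbourhood and the second neighbours of v are all distinct. *)
have ball : \sum_u D u * adj_sum x u + adj_sum x v + x v <= total_weight x + d * x v.
  have -> : \sum_u D u * adj_sum x u = \sum_w (\sum_u D u * A u w) * x w.
    rewrite /adj_sum; under eq_bigr do rewrite big_distrr /=.
    rewrite exchange_big /=; apply: eq_bigr => w _; rewrite big_distrl /=.
    by apply: eq_bigr => u _; rewrite mulnA.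
  have -> : x v = \sum_w (w == v) * x w.
    by rewrite (bigD1 v) //= eqxx mul1n big1 ?addn0 // => w /negPf ->.
  rewrite /total_weight big_distrr /= -!big_split /=; apply: leq_sum => w _.
  rewrite mulnA -!mulnDl -[X in _ <= X + _]mul1n -mulnDl leq_mul2r; apply/orP; right.
  have [->|wv] := eqVneq w v.
    rewrite Airr muln1 addn0 addnC leq_add2l /d; apply: leq_sum => u _.
    by case: (D u) => //; case: (A u v).
  rewrite muln0 !addn0.
  case Avw : (A v w).
    rewrite big1 // => u _; rewrite /D; case Avu : (A v u) => //=.
    case Auw : (A u w); rewrite ?muln0 //; exfalso.
    by apply: (noC3 v u w) => //; rewrite Asym.
  rewrite addn0 (eq_bigr (fun u => nat_of_bool (D u && A u w))).
    apply: sum_pred_le1 => a b /andP[/andP[va _] aw] /andP[/andP[vb _] bw].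
    by apply: (noC4 v a w b); rewrite // eq_sym.
  by move=> u _; rewrite mulnb.
have Nbr : d * total_weight x + 5 * adj_sum x v <= 5 * \sum_u D u * adj_sum x u.
  rewrite /d /adj_sum big_distrl big_distrr big_distrr -big_split /=.
  apply: leq_sum => u _; rewrite /D.
  case: (A v u) => //=; have [->|xu] := posnP (x u); first by rewrite muln0.
  by have := no u xu; rewrite /adj_sum !mul1n; lia.
(* For d = 3, [ball] and [Nbr] contradict the bound at [v]. For d = 2 they give S > 5 x(v), while
   [Nd] gives S < 5 x(v). For d <= 1, [Nd] alone is contradictory. *)
have := no v xv; move: d3 Nd ball Nbr.
case: d => [|[|[|[|//]]]] _; rewrite /adj_sum; lia.
Qed.
Lemma adj_sum_deg2 x u v : A u v -> #|[pred j | A u j]| <= 2 ->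
  adj_sum x u = x v \/
  exists w, [/\ w != v, A u w & adj_sum x u = x v + x w].
Proof.
move=> uv deg; rewrite /adj_sum (bigD1 v) //= uv mul1n.
have [w /andP[wv uw]|no] := pickP [pred w | (w != v) && A u w]; last first.
  left; rewrite big1 ?addn0 // => w wv.
  by have := no w; rewrite /= wv /= => ->.
right; exists w; split=> //; rewrite (bigD1 w) //= uw mul1n big1 ?addn0 //.
move=> t /andP[tv tw]; case ut : (A u t) => //.
move: deg; rewrite leqNgt => /negP[].
apply: (@leq_trans #|[:: v; w; t]|).
  rewrite (card_uniqP _) //= !inE negb_or eq_sym wv eq_sym tv /= andbT.
  by rewrite eq_sym tw.
by apply/subset_leq_card/fintype.subsetP => k; rewrite !inE => /or3P[] /eqP ->.
Qed.

Lemma sum_seq_total x (l : seq J) : uniq l -> \sum_(i <- l) x i <= total_weight x.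
Proof.
by move=> ul; rewrite big_uniq //= /total_weight [leqRHS](bigID (mem l)) /= leq_addr.
Qed.

(** With degrees at most 2, the surroundings of a vertex [v] of maximum weight form a path, followed
    for three steps on either side; the excluded cycles make six consecutive vertices distinct. The
    hexagon attains 1/6 = (2 - 1)/6. *)
Lemma adj_form_girth6 :
  (forall i, #|[pred j | A i j]| <= 2) ->
  (forall a b c, A a b -> A b c -> A c a -> False) ->
  (forall a b c d, a != c -> A a b -> A b c -> A a d -> A d c -> b = d) ->
  (forall a b c d e, A a b -> A b c -> A c d -> A d e -> A e a -> False) ->
  forall x, 6 * adj_form x <=
    total_weight x * total_weight x + 12 * total_weight x + 6 * sq_form x.
Proof.
move=> deg noC3 noC4 noC5; apply: (@adj_form_peel 6) => // x x0.
have [v xv vmax] := exists_max_weight x0.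
have [j /andP[h1 h2]|no] := pickP [pred j |
    (0 < x j) && (6 * adj_sum x j <= total_weight x + 6 * x j)].
  by exists j.
have {}no j : 0 < x j -> total_weight x + 6 * x j < 6 * adj_sum x j.
  by move=> xj; have := no j; rewrite /= xj /= ltnNge => ->.
exfalso.
have nov := no v xv.
have [u1 vu1] : exists u1, A v u1.
  apply/existsP; rewrite -[X in is_true X]negbK negb_exists; apply/negP => /forallP h.
  move: nov; rewrite /adj_sum big1 // => i _; by rewrite (negPf (h i)).
have [e|[u2 [u21 vu2 e]]] := adj_sum_deg2 x vu1 (deg v).
  by have := vmax u1; lia.
have xu1 : 0 < x u1 by have := vmax u2; lia.
have xu2 : 0 < x u2 by have := vmax u1; lia.
(* [lc] holds the vertex after [u] if it has positive weight and [lt] the one after that; empty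
   lists stand for a path that stops. *)
have side u : A v u -> 0 < x u -> exists lc lt, [/\
    [/\ uniq lc, uniq lt, {in lc, forall w, w != v /\ A u w} &
      {in lt, forall t, t != u /\ exists w, [/\ w != v, A u w & A w t]}],
    total_weight x + 6 * x u < 6 * (x v + \sum_(w <- lc) x w) &
    total_weight x + 6 * \sum_(w <- lc) x w < 6 * (x u + \sum_(t <- lt) x t) \/
    \sum_(w <- lc) x w = 0 /\ \sum_(t <- lt) x t = 0].
  move=> vu xu; have nou := no u xu.
  have uv : A u v by rewrite Asym.
  have [eu|[w [wv uw eu]]] := adj_sum_deg2 x uv (deg u).
    exists [::], [::]; rewrite !big_nil addn0; split=> //; last by right.
    by rewrite -eu.
  have [xw|xw] := posnP (x w).
    exists [::], [::]; rewrite !big_nil; split=> //; last by right.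
    by move: nou; rewrite eu xw.
  have now := no w xw.
  have wu : A w u by rewrite Asym.
  have [ew|[t [tu wt ew]]] := adj_sum_deg2 x wu (deg w).
    exists [:: w], [::]; rewrite !big_seq1 !big_nil addn0 -eu; split=> //.
      by split=> // ?; rewrite inE => /eqP ->.
    by left; rewrite -ew.
  exists [:: w], [:: t]; rewrite !big_seq1 -eu -ew; split=> //; last by left.
  split=> // ?; rewrite inE => /eqP -> //; split=> //; by exists w.
(* Only one third step is counted at a time: in a hexagon the third vertices on the two sides
   coincide. *)
have disj u u' lc lc' lt : A v u -> A v u' -> u != u' ->
    uniq lc -> uniq lc' -> uniq lt ->
    {in lc, forall w, w != v /\ A u w} -> {in lc', forall w, w != v /\ A u' w} ->
    {in lt, forall t, t != u /\ exists w, [/\ w != v, A u w & A w t]} ->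
    x v + (x u + x u') + \sum_(w <- lc) x w + \sum_(w <- lc') x w + \sum_(t <- lt) x t
      <= total_weight x.
  move=> vu vu' uu' ulc ulc' ult Plc Plc' Plt.
  have nvu : v != u by apply: contraTneq vu => ->; rewrite Airr.
  have nvu' : v != u' by apply: contraTneq vu' => ->; rewrite Airr.
  have uuA w : A u w -> A w u' -> w = v.
    move=> uw wu'; apply/eqP; apply/negPn/negP => wv.
    have := @noC4 v u w u'; rewrite eq_sym wv vu uw vu' Asym wu' => /(_ isT isT isT isT isT).
    by move/eqP; rewrite (negPf uu').
  have cat_disj (l1 l2 : seq J) : uniq l1 -> uniq l2 ->
      {in l2, forall w, w \notin l1} -> uniq (l1 ++ l2).
    by move=> ul1 ul2 h; rewrite cat_uniq ul1 ul2 andbT /= -all_predC; apply/allP.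
  have Nu w : A u w -> w != u by move=> uw; apply: contraTneq uw => ->; rewrite Airr.
  have Nu' w : A u' w -> w != u' by move=> uw; apply: contraTneq uw => ->; rewrite Airr.
  have nuu' : ~~ A u u'.
    by apply/negP => h; apply: (noC3 v u u') => //; rewrite Asym.
  have U1 : uniq ([:: v; u; u'] ++ lc).
    apply: cat_disj => //; first by rewrite /= !inE negb_or nvu nvu' uu'.
    move=> w /Plc [wv uw]; rewrite !inE !negb_or wv Nu //=.
    by apply: contraTneq uw => ->.
  have U2 : uniq (([:: v; u; u'] ++ lc) ++ lc').
    apply: cat_disj => // w /Plc' [wv uw]; rewrite mem_cat !inE !negb_or wv Nu' //= andbT.
    apply/andP; split; first by apply: contraTneq uw => ->; rewrite Asym.
    apply/negP => /Plc [_ uw2]; rewrite Asym in uw.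
    by rewrite (uuA w) ?eqxx in wv.
  have U3 : uniq ((([:: v; u; u'] ++ lc) ++ lc') ++ lt).
    apply: cat_disj => // t /Plt [tu [w [wv uw wt]]].
    rewrite !mem_cat !inE !negb_or tu /= -!andbA; apply/and4P; split.
    - by apply/eqP => e'; subst t; apply: (noC3 v u w).
    - by apply/eqP => e'; subst t; rewrite (uuA w) ?eqxx in wv.
    - apply/negP => /Plc [_ ut]; apply: (noC3 u w t) => //; by rewrite Asym.
    - apply/negP => /Plc' [_ ut]; apply: (noC5 v u w t u') => //; by rewrite Asym.
  by have := sum_seq_total x U3; rewrite !big_cat !big_cons big_nil /= addn0 !addnA.
have [lc1 [lt1 [[ulc1 ult1 Pc1 Pt1] n1 m1]]] := side u1 vu1 xu1.
have [lc2 [lt2 [[ulc2 ult2 Pc2 Pt2] n2 m2]]] := side u2 vu2 xu2.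
have u12 : u1 != u2 by rewrite eq_sym.
have D1 := disj _ _ _ _ _ vu1 vu2 u12 ulc1 ulc2 ult1 Pc1 Pc2 Pt1.
have D2 := disj _ _ _ _ _ vu2 vu1 u21 ulc2 ulc1 ult2 Pc2 Pc1 Pt2.
have := vmax u1; have := vmax u2; rewrite e in nov.
move: nov n1 n2 D1 D2 m1 m2 => {side disj no vmax}.
move: (\sum_(w <- lc1) x w) (\sum_(w <- lc2) x w) => c1 c2.
move: (\sum_(t <- lt1) x t) (\sum_(t <- lt2) x t) => t1 t2.
move: (total_weight x) (x v) (x u1) (x u2) => S a b1 b2.
(* When neither side stops early, four times the inequality at [v], three times those at its
   neighbours, once those at the second vertices and six times [D1] and [D2] add up to 0 < 0. If a
   side stops, maximality of [x v] is also used. *)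
by clear=> ? ? ? ? ? [?|[? ?]] [?|[? ?]] ? ?; lia.
Qed.
End WeightedGraph.

(** The components are paths on at most three vertices, with largest eigenvalue at most the square
    root of 2; the rational bound 3/2 is enough, being below ln 2 / ln(3/2). *)
Lemma adj_form_P4free (J : finType) (A : rel J) : symmetric A -> irreflexive A ->
  (forall i, #|[pred j | A i j]| <= 2) ->
  (forall a b c, A a b -> A b c -> A c a -> False) ->
  (forall a b c d, A a b -> A b c -> A c d ->
    a != c -> a != d -> b != d -> False) ->
  forall x, 2 * adj_form A x <= 3 * sq_form x.
Proof.
move=> Asym Airr deg noC3 noP4 x.
pose d i := #|[pred j | A i j]|.
(* 24 x y <= 9 x^2 + 16 y^2, and no edge joins two vertices of degree 2. *)
pose c i := if d i == 2 then 9 else 16.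
have edge i j : A i j -> 24 * (x i * x j) <= c i * (x i * x i) + c j * (x j * x j).
  move=> Aij; rewrite /c; case: eqP => di; case: eqP => dj; last 3 first.
  - by have := double_mul_le (3 * x i) (4 * x j); lia.
  - by have := double_mul_le (4 * x i) (3 * x j); lia.
  - by have := double_mul_le (x i) (x j); lia.
  have other u v : A u v -> d u = 2 -> exists2 w, A u w & w != v.
    move=> uv du; have [w /andP[uw wv]|no] := pickP [pred w | A u w && (w != v)].
      by exists w.
    have : d u <= #|[:: v]|.
      apply/subset_leq_card/fintype.subsetP => w; rewrite !inE => uw.
      by have := no w; rewrite /= uw /= => /negbFE.
    by rewrite du (card_uniqP _).
  have [a ia aj] := other _ _ Aij di.
  have [b jb bi] := other j i (etrans (Asym j i) Aij) dj.
  exfalso; apply: (noP4 a i j b) => //; rewrite 1?Asym // 1?eq_sym //.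
  apply/eqP => ab; subst b; apply: (noC3 i j a) => //; by rewrite Asym.
have h : 24 * adj_form A x <=
    \sum_i \sum_j (A i j * (c i * (x i * x i)) + A i j * (c j * (x j * x j))).
  rewrite /adj_form big_distrr /=; apply: leq_sum => i _.
  rewrite /adj_sum !big_distrr /=; apply: leq_sum => j _.
  case e : (A i j); last by rewrite !mul0n !muln0.
  by rewrite !mul1n; exact: edge.
have e : \sum_i \sum_j A i j * (c i * (x i * x i)) <= 18 * sq_form x.
  rewrite /sq_form big_distrr /=; apply: leq_sum => i _.
  rewrite -big_distrl /= mulnA leq_mul2r; apply/orP; right.
  have -> : \sum_j A i j = d i.
    rewrite /d -sum1_card [RHS]big_mkcond /=; apply: eq_bigr => j _.
    by rewrite inE; case: (A i j).
  by rewrite /c; have := deg i; rewrite -/(d i); case: (d i) => [|[|[|]]].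
have e2 : \sum_i \sum_j A i j * (c j * (x j * x j)) =
    \sum_i \sum_j A i j * (c i * (x i * x i)).
  rewrite exchange_big /=; apply: eq_bigr => j _; apply: eq_bigr => i _.
  by rewrite Asym.
move: h; under eq_bigr do rewrite big_split /=.
by rewrite big_split /= e2; lia.
Qed.

Local Open Scope ring_scope.

(** * Cloning *)

Definition ffun_upd (J V : finType) (Phi : {ffun J -> V}) (u : J)
    (x : V) : {ffun J -> V} :=
  [ffun k => if k == u then x else Phi k].

(** A uniform map stays uniform when one coordinate is resampled: exchanging the new value with the
    old one is an involution on pairs (Phi, x). *)
Lemma sum_resample (R : realType) (J V : finType) (u : J) (h : {ffun J -> V} -> R) :
  \sum_(Phi : {ffun J -> V}) \sum_(x : V) h (ffun_upd Phi u x) =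
  #|V|%:R * \sum_(Phi : {ffun J -> V}) h Phi.
Proof.
rewrite pair_big /=.
pose sw (p : {ffun J -> V} * V) := (ffun_upd p.1 u p.2, p.1 u).
have swK : involutive sw.
  move=> [Phi x]; rewrite /sw /=; congr pair; last by rewrite ffunE eqxx.
  by apply/ffunP => k; rewrite !ffunE; case: eqP => // ->.
rewrite (reindex_inj (inv_inj swK)) /=.
rewrite (eq_bigr (fun p => h p.1)) => [|[Phi x] _ /=]; last first.
  congr h; apply/ffunP => k; rewrite !ffunE; case: eqP => // ->; by [].
rewrite -(pair_big xpredT xpredT (fun Phi (_ : V) => h Phi)) /=.
by rewrite mulr_sumr; apply: eq_bigr => Phi _; rewrite sumr_const mulr_natl.
Qed.

Section Form.
Variables (V : finType) (wv : V -> V -> nat).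
Hypotheses (wvC : forall x y, wv x y = wv y x) (wvii : forall x, wv x x = 1%N)
  (wv1 : forall x y, (1 <= wv x y)%N).

Definition blow_form s (p : 'I_s -> V) : nat := (\sum_a \sum_b wv (p a) (p b))%N.

Lemma eq_form s (p p' : 'I_s -> V) : p =1 p' -> blow_form p = blow_form p'.
Proof. by move=> e; apply: eq_bigr => a _; apply: eq_bigr => b _; rewrite !e. Qed.

Lemma formD1 s (p : 'I_s -> V) c : blow_form p =
  (1 + 2 * \sum_(b | b != c) wv (p c) (p b) +
   \sum_(a | a != c) \sum_(b | b != c) wv (p a) (p b))%N.
Proof.
rewrite /blow_form (bigD1 c) //= (bigD1 c) //= wvii.
rewrite [X in (_ + X)%N](eq_bigr (fun a =>
  wv (p c) (p a) + \sum_(b | b != c) wv (p a) (p b))%N); last first.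
  by move=> a _; rewrite (bigD1 c) //= wvC.
by rewrite big_split /=; lia.
Qed.

Lemma form_change s (p p' : 'I_s -> V) c : (forall a, a != c -> p' a = p a) ->
  (\sum_(b | b != c) wv (p c) (p b) <= \sum_(b | b != c) wv (p' c) (p b))%N ->
  (blow_form p <= blow_form p')%N.
Proof.
move=> e le; rewrite (formD1 p c) (formD1 p' c).
have -> : (\sum_(b | b != c) wv (p' c) (p' b) =
    \sum_(b | b != c) wv (p' c) (p b))%N by apply: eq_bigr => b bc; rewrite (e b bc).
rewrite [X in (_ <= _ + X)%N](eq_bigr (fun a =>
   \sum_(b | b != c) wv (p a) (p b))%N).
  by rewrite leq_add2r leq_add2l leq_mul2l le orbT.
by move=> a ac; rewrite (e a ac); apply: eq_bigr => b bc; rewrite (e b bc).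
Qed.

(* [z] becomes a clone of [f c]: one of the two ways of distributing the
   values at [z] and [f c] does not decrease the sum. *)
Lemma form_clone s (J : finType) (f f' : 'I_s -> J) (c d : 'I_s) (z : J)
    (Phi : {ffun J -> V}) (B : nat) :
  c != d -> f c = f d -> (forall a, f a != z) ->
  (forall a, f' a = if a == c then z else f a) ->
  (B < blow_form (Phi \o f))%N -> (B < blow_form ((Phi \o tperm (f c) z) \o f))%N ->
  (B < blow_form (Phi \o f'))%N || (B < blow_form ((Phi \o tperm (f c) z) \o f'))%N.
Proof.
move=> cd fcd fz f'E h1 h2.
pose g x := (\sum_(b | f b != f c) wv x (Phi (f b)))%N.
have f'c : f' c = z by rewrite f'E eqxx.
have f'n a : a != c -> f' a = f a by move=> /negPf ac; rewrite f'E ac.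
have split x (p : 'I_s -> V) : (\sum_(b | b != c) wv x (p b) =
    \sum_(b | (b != c) && (f b == f c)) wv x (p b) +
    \sum_(b | f b != f c) wv x (p b))%N.
  rewrite (bigID (fun b => f b == f c)) /=; congr (_ + _)%N.
  apply: eq_bigl => b; rewrite andbC; case: (f b =P f c) => //= nb.
  by apply/eqP => e; rewrite e in nb.
have [le|/ltnW le] := leqP (g (Phi (f c))) (g (Phi z)).
  apply/orP; left; apply: leq_trans h1 _.
  apply: (form_change (c := c)) => [a ac /=|]; first by rewrite f'n.
  rewrite /= f'c !split; apply: leq_add; last exact: le.
  by apply: leq_sum => b /andP[_ /eqP ->]; rewrite wvii.
apply/orP; right; apply: leq_trans h2 _.
apply: (form_change (c := c)) => [a ac /=|]; first by rewrite f'n.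
rewrite /= f'c tpermL tpermR !split; apply: leq_add.
  by apply: leq_sum => b /andP[_ /eqP ->]; rewrite tpermL wvii.
rewrite (eq_bigr (fun b => wv (Phi z) (Phi (f b)))) => [|b bc]; last first.
  by rewrite tpermD // eq_sym.
rewrite [X in (_ <= X)%N](eq_bigr (fun b => wv (Phi (f c)) (Phi (f b)))) //.
by move=> b bc; rewrite tpermD // eq_sym.
Qed.

(** As [f] avoids [z], the values at [f c] and [z] are independent copies given the other
    coordinates. By Cauchy-Schwarz, [Phi] and its transposition are both bad with probability at
    least eps^2; then by [form_clone] one of them is bad for [f'], whence the factor 1/2. *)
Lemma clone_count (R : realType) s (J : finType) (f f' : 'I_s -> J) (c d : 'I_s)
    (z : J) (B : nat) (eps : R) :
  c != d -> f c = f d -> (forall a, f a != z) ->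
  (forall a, f' a = if a == c then z else f a) -> 0 < eps -> (0 < #|V|)%N ->
  eps * #|{ffun J -> V}|%:R <
    \sum_(Phi : {ffun J -> V}) (B < blow_form (Phi \o f))%N%:R ->
  eps ^+ 2 / 2 * #|{ffun J -> V}|%:R <
    \sum_(Phi : {ffun J -> V}) (B < blow_form (Phi \o f'))%N%:R.
Proof.
move=> cd fcd fz f'E eps0 V0 big.
set N := _%:R in big *.
pose u := f c.
have uz : u != z by exact: fz.
pose A (Phi : {ffun J -> V}) : R := (B < blow_form (Phi \o f))%N%:R.
pose A' (Phi : {ffun J -> V}) : R := (B < blow_form (Phi \o f'))%N%:R.
pose tau (Phi : {ffun J -> V}) : {ffun J -> V} := [ffun k => Phi (tperm u z k)].
have tauK : involutive tau.
  by move=> Phi; apply/ffunP => k; rewrite !ffunE tpermK.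
have sumtau h : \sum_Phi h (tau Phi) = \sum_Phi h Phi :> R.
  by rewrite [RHS](reindex_inj (inv_inj tauK)).
have leA : \sum_Phi A Phi * A (tau Phi) <= 2 * \sum_Phi A' Phi.
  have -> : 2 * \sum_Phi A' Phi = \sum_Phi (A' Phi + A' (tau Phi)).
    by rewrite big_split /= sumtau; ring.
  apply: ler_sum => Phi _; rewrite /A /A'.
  have e (k : 'I_s -> J) : blow_form (tau Phi \o k) = blow_form ((Phi \o tperm u z) \o k).
    by apply: eq_form => a; rewrite /= ffunE.
  rewrite !e.
  case h1 : (B < blow_form (Phi \o f))%N; last by rewrite mul0r addr_ge0.
  case h2 : (B < blow_form ((Phi \o tperm u z) \o f))%N; last by rewrite mulr0 addr_ge0.
  rewrite mulr1.
  case/orP: (form_clone cd fcd fz f'E h1 h2) => ->.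
    by rewrite lerDl.
  by rewrite lerDr.
(* Up to the factor [#|V|], the conditional probability of [A] given all coordinates but [u]. *)
pose g Phi : R := \sum_x A (ffun_upd Phi u x).
set n : R := #|V|%:R.
have n0 : 0 < n by rewrite ltr0n.
have sA : n * \sum_Phi A Phi = \sum_Phi g Phi by rewrite -(sum_resample u).
have Az Phi x y : A (ffun_upd (ffun_upd Phi z y) u x) = A (ffun_upd Phi u x).
  rewrite /A (@eq_form _ _ (ffun_upd Phi u x \o f)) // => a /=.
  by rewrite !ffunE (negPf (fz a)).
have sAA : n * (n * \sum_Phi A Phi * A (tau Phi)) = \sum_Phi g Phi ^+ 2.
  rewrite -(sum_resample u) -(sum_resample z).
  apply: eq_bigr => Phi _; rewrite expr2 /g mulr_suml exchange_big /=.
  apply: eq_bigr => x _; rewrite mulr_sumr; apply: eq_bigr => y _.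
  rewrite Az; congr (_ * _).
  rewrite /A (@eq_form _ _ (ffun_upd Phi u y \o f)) // => a /=.
  rewrite !ffunE; case: tpermP => [->|e|/eqP nu /eqP nz].
  - by rewrite eqxx (eq_sym z) (negPf uz) eqxx.
  - by have := fz a; rewrite e eqxx.
  - by rewrite (negPf nu) (negPf nz).
(* Cauchy-Schwarz in tangent form, by expanding (g - eps n)^2 >= 0. *)
have tangent : \sum_Phi g Phi ^+ 2 >= 2 * (eps * n) * \sum_Phi g Phi - (eps * n) ^+ 2 * N.
  have -> : (eps * n) ^+ 2 * N = \sum_(Phi : {ffun J -> V}) (eps * n) ^+ 2.
    by rewrite sumr_const mulr_natr.
  rewrite mulr_sumr -sumrB; apply: ler_sum => Phi _.
  rewrite -subr_ge0 (_ : _ - _ = (g Phi - eps * n) ^+ 2) ?sqr_ge0 //; ring.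
rewrite -sA -sAA in tangent.
have : eps ^+ 2 * N < \sum_Phi A Phi * A (tau Phi).
  rewrite -(ltr_pM2l n0) -(ltr_pM2l n0).
  apply: lt_le_trans tangent.
  have : 0 < eps * n * n * (\sum_Phi A Phi - eps * N).
    by rewrite !mulr_gt0 ?subr_gt0.
  lra.
rewrite /A' in leA; lra.
Qed.
End Form.

Section Clones.
Variables (R : realType) (s q m : nat).
Hypothesis (sm : (s <= m)%N).

Lemma count_collision (J V : finType) (a b : J) : a != b ->
  #|V|%:R * \sum_(Phi : {ffun J -> V}) (Phi a == Phi b)%:R =
  #|{ffun J -> V}|%:R :> R.
Proof.
move=> ab; rewrite -(sum_resample a) -sum1_card natr_sum.
apply: eq_bigr => Phi _; rewrite (bigD1 (Phi b)) //=.
rewrite !ffunE eqxx [b == a]eq_sym (negPf ab) eqxx.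
rewrite big1 ?addr0 // => x xb.
by rewrite !ffunE eqxx [b == a]eq_sym (negPf ab) (negPf xb).
Qed.

Lemma form_inj_le (V : finType) (w : multigraph V) (p : 'I_s -> V) :
  sq_graph s q w -> injective p -> (blow_form (wt w) p <= 2 * q + s)%N.
Proof.
move=> sqw pinj.
have cX : #|[set p a | a in 'I_s]| = s by rewrite card_imset // card_ord.
have := mg_sum_wt w [set p a | a in 'I_s]; have := sqw _ cX.
rewrite cX big_imset /=; last by move=> x y _ _; exact: pinj.
rewrite (eq_bigr (fun a => \sum_b wt w (p a) (p b))%N).
  by rewrite /blow_form => le <-; rewrite leq_add2r leq_mul2l le orbT.
by move=> a _; rewrite big_imset // => x y _ _; exact: pinj.
Qed.

Lemma few_blow_ups (f : 'I_s -> 'I_m) (eps : R) : 0 < eps ->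
  exists N : nat, forall n, (N <= n)%N -> forall w : multigraph 'I_n,
    sq_graph s q w -> (forall i j, 1 <= wt w i j)%N ->
    \sum_(Phi : {ffun 'I_m -> 'I_n}) (2 * q + s < blow_form (wt w) (Phi \o f))%N%:R
      <= eps * #|{ffun 'I_m -> 'I_n}|%:R.
Proof.
have [k] := ubnP (s - #|[set f a | a in 'I_s]|); elim: k f eps => // k IH f eps lek eps0.
have [finj|] := boolP (injectiveb f).
  exists (Num.bound (s%:R ^+ 2 / eps)).+1 => n Nn w sqw w1.
  set N : R := _%:R.
  have n0 : 0 < n%:R :> R by rewrite ltr0n (leq_ltn_trans _ Nn).
  have le Phi : (2 * q + s < blow_form (wt w) (Phi \o f))%N%:R <=
      \sum_a \sum_(b | b != a) (Phi (f a) == Phi (f b))%:R :> R.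
    case: ltnP => [lt|_]; last by rewrite !sumr_ge0 // => ? _; rewrite sumr_ge0.
    have [ninj|/injectivePn[a [b ab e]]] := boolP (injectiveb (Phi \o f)).
      by have := form_inj_le sqw (injectiveP _ ninj); rewrite leqNgt lt.
    rewrite (bigD1 a) //= (bigD1 b) 1?eq_sym //= [Phi (f a)]e eqxx -addrA lerDl.
    by rewrite addr_ge0 // sumr_ge0 // => ? _; rewrite ?sumr_ge0.
  apply: (@le_trans _ _ (\sum_(Phi : {ffun 'I_m -> 'I_n})
      \sum_a \sum_(b | b != a) (Phi (f a) == Phi (f b))%:R)).
    by apply: ler_sum.
  rewrite exchange_big /=; under eq_bigr do rewrite exchange_big /=.
  have cc a b : b != a ->
      \sum_(Phi : {ffun 'I_m -> 'I_n}) (Phi (f a) == Phi (f b))%:R = N / n%:R :> R.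
    move=> ba; rewrite /N -(@count_collision _ _ (f a) (f b)) ?card_ord.
      by rewrite mulrC mulKf // gt_eqF.
    by rewrite (inj_eq (injectiveP _ finj)) eq_sym.
  apply: (@le_trans _ _ (\sum_(a < s) \sum_(b < s) N / n%:R)).
    apply: ler_sum => a _; rewrite [leRHS](bigID (fun b => b != a)) /=.
    rewrite (eq_bigr (fun=> N / n%:R)) => [|b ba]; last exact: cc.
    rewrite lerDl sumr_ge0 // => ? _; rewrite divr_ge0 ?ler0n //; exact: ltW.
  rewrite !sumr_const card_ord -mulrnA -[_ *+ (s * s)]mulr_natr mulrAC ler_pdivrMr //.
  rewrite -mulrA mulrCA ler_wpM2l ?ler0n // mulrC -ler_pdivrMr // natrM -expr2.
  apply: ltW; apply: lt_trans (archi_boundP _) _.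
    by rewrite divr_ge0 ?exprn_ge0 ?ler0n ?(ltW eps0).
  by rewrite ltr_nat.
case/injectivePn => c [d cd fcd].
have ltim : (#|[set f a | a in 'I_s]| < s)%N.
  rewrite ltn_neqAle -[X in _ && (_ <= X)%N](card_ord s) leq_imset_card andbT.
  apply/negP => e; have : injective f; last by move=> /(_ _ _ fcd) /eqP; apply/negP.
  apply: in2T; apply/imset_injP; by rewrite (eqP e) card_ord.
have [z zf] : exists z, z \notin [set f a | a in 'I_s].
  apply/existsP; rewrite -negb_forall; apply/negP => /forallP all.
  have : (#|'I_m| <= #|[set f a | a in 'I_s]|)%N by apply/subset_leq_card/fintype.subsetP.
  by rewrite card_ord leqNgt (leq_trans ltim).
have fz a : f a != z by apply: contraNneq zf => <-; rewrite imset_f.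
pose f' a := if a == c then z else f a.
have imf' : (#|[set f a | a in 'I_s]| < #|[set f' a | a in 'I_s]|)%N.
  apply: proper_card; apply/properP; split; last first.
    by exists z => //; apply/imsetP; exists c; rewrite // /f' eqxx.
  apply/fintype.subsetP => _ /imsetP[a _ ->]; apply/imsetP.
  have [->|ac] := eqVneq a c; last by exists a; rewrite // /f' (negPf ac).
  by exists d; rewrite // /f' eq_sym (negPf cd).
have [||N HN] := IH f' (eps ^+ 2 / 2).
- exact: leq_trans (ltn_sub2l ltim imf') lek.
- by rewrite divr_gt0 ?exprn_gt0.
(* The successor makes ['I_n] nonempty. *)
exists N.+1 => n Nn w sqw w1; rewrite leNgt; apply/negP => lt.
have := HN n (ltnW Nn) w sqw w1; rewrite leNgt => /negP; apply.
apply: (clone_count (@wtC _ w) (@wtii _ w) w1 cd fcd fz) => //.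
by rewrite card_ord (leq_ltn_trans _ Nn).
Qed.
End Clones.

Local Close Scope ring_scope.

(** * Forbidden configurations *)

(* [W] is a multigraph with loops of weight 1 all of whose blow-ups on s vertices
   have sum at most q. *)
Section Closed.
Variables (s q : nat) (J : finType) (W : J -> J -> nat).
Hypotheses (WC : forall x y, W x y = W y x) (Wii : forall x, W x x = 1)
  (Wq : forall p : 'I_s -> J, blow_form W p <= 2 * q + s).

Lemma closed_seq (l : seq J) : size l = s ->
  \sum_(x <- l) \sum_(y <- l) W x y <= 2 * q + s.
Proof.
case: l => [<-|x0 l0]; first by rewrite big_nil.
set l := x0 :: l0 => sl.
apply: leq_trans (Wq (fun a => nth x0 l a)); rewrite /blow_form.
rewrite (big_nth x0) big_mkord sl; apply: leq_sum => a _.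
by rewrite (big_nth x0) big_mkord sl; apply: leq_sum => b _.
Qed.

(** Every blow-up of the pattern is dominated by one of [W] through [g]. Read contrapositively, q <
    Sigma forbids [W] to contain the pattern, even with larger weights. *)
Lemma closed_embed (T : finType) (E : {set {set T}}) (g : T -> J) :
  (forall i j, graph_pattern E 2 [set i; j]%SET <= W (g i) (g j)) ->
  Sigma (graph_pattern E 2) s <= q.
Proof.
move=> h; apply: Sigma_le => f; apply: leq_trans (Wq (g \o f)).
by apply: leq_sum => a _; apply: leq_sum => b _; apply: h.
Qed.

Section Star4.
Hypothesis q4 : q < Sigma (graph_pattern (star 4) 2) s.

(** Strictness of q < Sigma gains 8, enough to absorb the rounding in balanced blow-ups. Their
    densities are at least 10/4 for a pair of weight 4, 7/3 for a triangle and 9/4 for a C_4 of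
    weight 3, hence all excluded. *)
Let bound4 : 4 * (2 * q + s) + 8 <= 9 * (s * s).
Proof. by have := Sigma_star4_le s; lia. Qed.

Lemma closed_le3 i j : W i j <= 3.
Proof.
have [->|ij] := eqVneq i j; first by rewrite Wii.
rewrite leqNgt; apply/negP => lt.
have key a b : a + b = s -> a * a + b * b + 8 * (a * b) <= 2 * q + s.
  move=> e; have := @closed_seq (nseq a i ++ nseq b j).
  rewrite size_cat !size_nseq => /(_ e).
  rewrite !(big_cat, sum_nseq_nat) /= !Wii (WC j i); apply: leq_trans.
  by have := leq_mul (leqnn (a * b)) lt; lia.
have := divn_eq s 2; have : s %% 2 < 2 by rewrite ltn_mod.
move: (s %/ 2) (s %% 2) => k [|[|//]] _ e.
- by have := key k k; lia.
- by have := key k k.+1; lia.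
Qed.

Lemma closed_noC3 i j k : W i j = 3 -> W j k = 3 -> W k i = 3 -> False.
Proof.
move=> ij jk ki.
have key a b c : a + b + c = s ->
    a * a + b * b + c * c + 6 * (a * b + b * c + a * c) <= 2 * q + s.
  move=> e; have := @closed_seq (nseq a i ++ nseq b j ++ nseq c k).
  rewrite !size_cat !size_nseq addnA => /(_ e).
  rewrite !(big_cat, sum_nseq_nat) /= !Wii (WC j i) (WC k j) (WC i k) ij jk ki => le.
  by apply: leq_trans le; apply: eq_leq; ring.
have := divn_eq s 3; have : s %% 3 < 3 by rewrite ltn_mod.
move: (s %/ 3) (s %% 3) => h [|[|[|//]]] _ e.
- by have := key h h h; lia.
- by have := key h.+1 h h; lia.
- by have := key h.+1 h.+1 h; lia.
Qed.

Lemma closed_noC4 i j k l : W i j = 3 -> W j k = 3 -> W k l = 3 -> W l i = 3 ->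
  W i k = 2 -> W j l = 2 -> False.
Proof.
move=> ij jk kl li ik jl.
have key a b c d : a + b + c + d = s -> a * a + b * b + c * c + d * d +
    6 * (a * b + b * c + c * d + d * a) + 4 * (a * c + b * d) <= 2 * q + s.
  move=> e; have := @closed_seq (nseq a i ++ nseq b j ++ nseq c k ++ nseq d l).
  rewrite !size_cat !size_nseq !addnA => /(_ e).
  rewrite !(big_cat, sum_nseq_nat) /= !Wii (WC j i) (WC k j) (WC l k) (WC i l).
  rewrite (WC k i) (WC l j) ij jk kl li ik jl => le.
  by apply: leq_trans le; apply: eq_leq; ring.
have := divn_eq s 4; have : s %% 4 < 4 by rewrite ltn_mod.
move: (s %/ 4) (s %% 4) => h [|[|[|[|//]]]] _ e.
- by have := key h h h h; lia.
- by have := key h.+1 h h h; lia.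
- by have := key h.+1 h.+1 h h; lia.
- by have := key h.+1 h.+1 h.+1 h; lia.
Qed.
End Star4.

(** A balanced C_5 has density (1 + 2 * 3 + 2 * 2)/5 = 11/5, equal to that of K_{1,3}; the 10 gained
    from q < Sigma exceeds the rounding loss. *)
Lemma closed_noC5 i j k l n : q < Sigma (graph_pattern (star 3) 2) s ->
  W i j = 3 -> W j k = 3 -> W k l = 3 -> W l n = 3 -> W n i = 3 ->
  W i k = 2 -> W i l = 2 -> W j l = 2 -> W j n = 2 -> W k n = 2 -> False.
Proof.
move=> q3 ij jk kl ln ni ik il jl jn kn.
have b5 : 5 * (2 * q + s) + 10 <= 11 * (s * s) by have := Sigma_star3_le s; lia.
have key a b c d f : a + b + c + d + f = s ->
    a * a + b * b + c * c + d * d + f * f +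
    6 * (a * b + b * c + c * d + d * f + f * a) +
    4 * (a * c + a * d + b * d + b * f + c * f) <= 2 * q + s.
  move=> e.
  have := @closed_seq (nseq a i ++ nseq b j ++ nseq c k ++ nseq d l ++ nseq f n).
  rewrite !size_cat !size_nseq !addnA => /(_ e).
  rewrite !(big_cat, sum_nseq_nat) /= !Wii (WC j i) (WC k j) (WC l k) (WC n l) (WC i n).
  rewrite (WC k i) (WC l i) (WC l j) (WC n j) (WC n k) ij jk kl ln ni ik il jl jn kn => le.
  by apply: leq_trans le; apply: eq_leq; ring.
have := divn_eq s 5; have : s %% 5 < 5 by rewrite ltn_mod.
move: (s %/ 5) (s %% 5) => h [|[|[|[|[|//]]]]] _ e.
- by have := key h h h h h; lia.
- by have := key h.+1 h h h h; lia.
- by have := key h.+1 h.+1 h h h; lia.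
- by have := key h.+1 h.+1 h.+1 h h; lia.
- by have := key h.+1 h.+1 h.+1 h.+1 h; lia.
Qed.

(** * The graph of weight-3 pairs on a set without pairs of weight 1 *)

Section Support.
Variable (U : pred J).
Hypothesis U2 : forall i j, U i -> U j -> i != j -> 2 <= W i j.

Definition heavy i j := [&& U i, U j & W i j == 3].

Lemma heavy_sym : symmetric heavy.
Proof. by move=> i j; rewrite /heavy WC andbCA. Qed.

Lemma heavy_irr : irreflexive heavy.
Proof. by move=> i; rewrite /heavy Wii !andbF. Qed.

(** A vertex with [l] heavy neighbours is the centre of an embedded K_{1,l}: distinct leaves have
    mutual weight at least 2 by [U2]. *)
Lemma heavy_deg l i : q < Sigma (graph_pattern (star l) 2) s ->
  #|[pred j | heavy i j]| < l.
Proof.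
move=> ql; rewrite ltnNge; apply/negP => le.
move: ql; rewrite ltnNge => /negP; apply.
pose e := enum [pred j | heavy i j].
have se : l <= size e by rewrite -cardE.
have eP k : k < l -> heavy i (nth i e k).
  move=> kl; have : nth i e k \in e by apply: mem_nth; apply: leq_trans se.
  by rewrite mem_enum inE.
pose g (k : 'I_l.+1) := if k == 0 :> nat then i else nth i e k.-1.
apply: (@closed_embed _ _ g) => a b; rewrite star_patternE /g.
have [->|ab] := eqVneq (a : nat) b; first by rewrite Wii.
have [a0|a0] := eqVneq (a : nat) 0; have [b0|b0] := eqVneq (b : nat) 0.
- by rewrite a0 b0 in ab.
- have: heavy i (nth i e b.-1) by apply: eP; rewrite prednK ?lt0n // -ltnS.
  by case/and3P => _ _ /eqP ->.
- have: heavy i (nth i e a.-1) by apply: eP; rewrite prednK ?lt0n // -ltnS.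
  by case/and3P => _ _; rewrite WC => /eqP ->.
have ha : a.-1 < l by rewrite prednK ?lt0n // -ltnS.
have hb : b.-1 < l by rewrite prednK ?lt0n // -ltnS.
have /and3P[_ Ua _] := eP _ ha; have /and3P[_ Ub _] := eP _ hb.
apply: U2 => //; rewrite nth_uniq ?enum_uniq ?(leq_trans _ se) //.
by move: ab a0 b0; lia.
Qed.

Lemma heavy_noC3 : q < Sigma (graph_pattern (star 4) 2) s ->
  forall a b c, heavy a b -> heavy b c -> heavy c a -> False.
Proof.
move=> q4 a b c /and3P[_ _ /eqP ab] /and3P[_ _ /eqP bc] /and3P[_ _ /eqP ca].
exact: (closed_noC3 q4 ab bc ca).
Qed.

Lemma heavy2_W2 a b c : q < Sigma (graph_pattern (star 4) 2) s ->
  a != c -> heavy a b -> heavy b c -> W a c = 2.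
Proof.
move=> q4 ac hab hbc.
have /and3P[Ua _ _] := hab; have /and3P[_ Uc _] := hbc.
have := U2 Ua Uc ac; have := closed_le3 q4 a c.
have [e|] := eqVneq (W a c) 3; last lia.
exfalso; apply: (heavy_noC3 q4 hab hbc).
by rewrite /heavy Ua Uc WC e.
Qed.

Lemma heavy_noC4 : q < Sigma (graph_pattern (star 4) 2) s ->
  forall a b c d, a != c -> heavy a b -> heavy b c -> heavy a d -> heavy d c -> b = d.
Proof.
move=> q4 a b c d ac ab bc ad dc; apply/eqP/negPn/negP => bd.
have ac2 := heavy2_W2 q4 ac ab bc.
have bd2 : W b d = 2 by apply: (heavy2_W2 q4 bd _ ad); rewrite heavy_sym.
rewrite heavy_sym in ad; rewrite heavy_sym in dc.
move: ab bc dc ad => /and3P[_ _ /eqP ab] /and3P[_ _ /eqP bc].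
move=> /and3P[_ _ /eqP cd] /and3P[_ _ /eqP da].
exact: (closed_noC4 q4 ab bc cd da).
Qed.

Lemma heavy_noC5 : q < Sigma (graph_pattern (star 4) 2) s ->
  q < Sigma (graph_pattern (star 3) 2) s ->
  forall a b c d e, heavy a b -> heavy b c -> heavy c d -> heavy d e -> heavy e a -> False.
Proof.
move=> q4 q3 a b c d e ab bc cd de ea.
(* Identifying two vertices at distance two on a closed 5-walk leaves a triangle. *)
have ne x y z t u : heavy x y -> heavy y z -> heavy z t -> heavy t u -> heavy u x -> x != z.
  move=> xy yz zt tu ux; apply/eqP => E; subst z.
  exact: (heavy_noC3 q4 zt tu ux).
have ac2 := heavy2_W2 q4 (ne _ _ _ _ _ ab bc cd de ea) ab bc.
have bd2 := heavy2_W2 q4 (ne _ _ _ _ _ bc cd de ea ab) bc cd.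
have ce2 := heavy2_W2 q4 (ne _ _ _ _ _ cd de ea ab bc) cd de.
have da2 := heavy2_W2 q4 (ne _ _ _ _ _ de ea ab bc cd) de ea.
have eb2 := heavy2_W2 q4 (ne _ _ _ _ _ ea ab bc cd de) ea ab.
move: ab bc cd de ea => /and3P[_ _ /eqP ab] /and3P[_ _ /eqP bc].
move=> /and3P[_ _ /eqP cd] /and3P[_ _ /eqP de] /and3P[_ _ /eqP ea].
by apply: (closed_noC5 q3 ab bc cd de ea); rewrite // WC.
Qed.

Lemma heavy_noP4 : q < Sigma (graph_pattern path4 2) s ->
  forall a b c d, heavy a b -> heavy b c -> heavy c d ->
    a != c -> a != d -> b != d -> False.
Proof.
move=> qP a b c d ab bc cd ac ad bd.
move: qP; rewrite ltnNge => /negP; apply.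
pose g (k : 'I_4) := nth a [:: a; b; c; d] k.
apply: (@closed_embed _ _ g) => i j; rewrite path4_patternE /g.
move: ab bc cd => /and3P[Ua Ub /eqP ab] /and3P[_ Uc /eqP bc] /and3P[_ Ud /eqP cd].
have W2ac := U2 Ua Uc ac; have W2ad := U2 Ua Ud ad; have W2bd := U2 Ub Ud bd.
by case: i => [[|[|[|[|//]]]] /= _]; case: j => [[|[|[|[|//]]]] /= _];
  rewrite ?Wii ?ab ?bc ?cd // WC ?ab ?bc ?cd.
Qed.
End Support.
End Closed.

Local Open Scope ring_scope.

(** * Symmetrisation *)

Section Zykov.
Variables (R : realType) (J : finType).

Definition log_form (L : J -> J -> R) (x : J -> nat) : R :=
  \sum_i \sum_j (x i)%:R * (x j)%:R * L i j.

Definition merge_weights (x : J -> nat) (u v : J) : J -> nat :=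
  fun k => if k == u then (x u + x v)%N else if k == v then 0%N else x k.

Lemma total_merge x u v : u != v -> total_weight (merge_weights x u v) = total_weight x.
Proof.
move=> uv; rewrite /total_weight (bigD1 u) //= (bigD1 v) 1?eq_sym //=.
rewrite [RHS](bigD1 u) //= [in RHS](bigD1 v) 1?eq_sym //= /merge_weights !eqxx.
rewrite eq_sym (negPf uv) add0n addnA; congr (_ + _)%N.
by apply: eq_bigr => k /andP[/negPf -> /negPf ->].
Qed.

Lemma quad_split L x u v : (forall i j, L i j = L j i) -> u != v ->
  log_form L x = (x u)%:R ^+ 2 * L u u + (x v)%:R ^+ 2 * L v v +
    2 * (x u)%:R * (x v)%:R * L u v +
    2 * (x u)%:R * (\sum_(k | (k != u) && (k != v)) (x k)%:R * L u k) +
    2 * (x v)%:R * (\sum_(k | (k != u) && (k != v)) (x k)%:R * L v k) +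
    \sum_(i | (i != u) && (i != v)) \sum_(j | (j != u) && (j != v))
       (x i)%:R * (x j)%:R * L i j.
Proof.
move=> LC uv.
have vu : v != u by rewrite eq_sym.
pose G i := \sum_(k | (k != u) && (k != v)) (x k)%:R * L i k.
have row i : \sum_j (x i)%:R * (x j)%:R * L i j =
    (x i)%:R * (x u)%:R * L i u + (x i)%:R * (x v)%:R * L i v + (x i)%:R * G i.
  rewrite (bigD1 u) //= (bigD1 v) //= addrA; congr (_ + _).
  by rewrite mulr_sumr; apply: eq_bigr => j _; rewrite mulrA.
pose F i := \sum_j (x i)%:R * (x j)%:R * L i j.
have -> : log_form L x = F u + (F v + \sum_(i | (i != u) && (i != v)) F i).
  by rewrite -[log_form L x]/(\sum_i F i) (bigD1 u) //= (bigD1 v).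
have -> : \sum_(i | (i != u) && (i != v)) F i =
    (x u)%:R * G u + (x v)%:R * G v +
    \sum_(i | (i != u) && (i != v)) \sum_(j | (j != u) && (j != v))
       (x i)%:R * (x j)%:R * L i j.
  rewrite {1 2}/G !mulr_sumr -!big_split /=; apply: eq_bigr => i _.
  rewrite /F row (LC u i) (LC v i) /G mulr_sumr.
  rewrite (eq_bigr (fun j => (x i)%:R * (x j)%:R * L i j)); first by ring.
  by move=> j _; rewrite mulrA.
rewrite /F !row -/(G u) -/(G v) (LC v u); ring.
Qed.

(** Since [L] is constant on {u, v}, its contribution there depends only on x(u) + x(v). The form is
    thus affine in a shift of weight between [u] and [v], and one extreme is no worse. *)
Lemma quad_merge L x u v : (forall i j, L i j = L j i) -> u != v ->
  L u u = L u v -> L v v = L u v ->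
  log_form L x <= log_form L (merge_weights x u v) \/
  log_form L x <= log_form L (merge_weights x v u).
Proof.
move=> LC uv Lu Lv.
have vu : v != u by rewrite eq_sym.
set G := fun i => \sum_(k | (k != u) && (k != v)) (x k)%:R * L i k.
have mG i a b : (a = u /\ b = v) \/ (a = v /\ b = u) ->
    \sum_(k | (k != u) && (k != v)) (merge_weights x a b k)%:R * L i k = G i.
  move=> ab; apply: eq_bigr => k /andP[/negPf ku /negPf kv].
  by case: ab => -[-> ->]; rewrite /merge_weights ku kv.
have mK a b : (a = u /\ b = v) \/ (a = v /\ b = u) ->
    \sum_(i | (i != u) && (i != v)) \sum_(j | (j != u) && (j != v))
       (merge_weights x a b i)%:R * (merge_weights x a b j)%:R * L i j =
    \sum_(i | (i != u) && (i != v)) \sum_(j | (j != u) && (j != v))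
       (x i)%:R * (x j)%:R * L i j.
  move=> ab; apply: eq_bigr => i /andP[/negPf iu /negPf iv].
  apply: eq_bigr => j /andP[/negPf ju /negPf jv].
  by case: ab => -[-> ->]; rewrite /merge_weights iu iv ju jv.
rewrite !(quad_split _ LC uv) !mG ?mK; try by [left|right].
rewrite -!/(G _) Lu Lv /merge_weights !eqxx (negPf uv) (negPf vu) !natrD.
move: (\sum_(i | _) _) => K.
have a0 : 0 <= (x u)%:R :> R by []; have b0 : 0 <= (x v)%:R :> R by [].
move: (x u)%:R (x v)%:R a0 b0 (G u) (G v) (L u v) => a b a0 b0 g h l.
have [le|/ltW le] := leP h g; [left|right].
  by have := mulr_ge0 b0 (etrans (subr_ge0 _ _) le); lra.
by have := mulr_ge0 a0 (etrans (subr_ge0 _ _) le); lra.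
Qed.

(** Each merge along a pair of weight 1 keeps the total weight and shrinks the support, so it ends
    at a support where all weights are at least 2. *)
Lemma zykov (L : J -> J -> R) (W : J -> J -> nat) (bound : nat -> R) :
  (forall i j, L i j = L j i) -> (forall i j, 1 <= W i j)%N ->
  (forall u v, W u v = 1%N -> L u u = L u v /\ L v v = L u v) ->
  (forall x, (forall i j, 0 < x i -> 0 < x j -> i != j -> 2 <= W i j)%N ->
     log_form L x <= bound (total_weight x)) ->
  forall x, log_form L x <= bound (total_weight x).
Proof.
move=> LC W1 LW base x.
have [k] := ubnP #|[pred i | 0 < x i]%N|; elim: k x => // k IH x lek.
have [[u v] /and4P[xu xv uv Wuv]|no] := pickP
  [pred p : J * J | [&& 0 < x p.1, 0 < x p.2, p.1 != p.2 & W p.1 p.2 < 2]%N]; last first.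
  apply: base => i j xi xj ij; rewrite leqNgt; apply/negP => lt.
  by have := no (i, j); rewrite /= xi xj ij lt.
have /LW[Lu Lv] : W u v = 1%N by apply/eqP; rewrite eqn_leq W1 andbT.
have vu : v != u by rewrite eq_sym.
have small a b : (0 < x a)%N -> (0 < x b)%N -> a != b ->
    (#|[pred i | 0 < merge_weights x a b i]%N| < k)%N.
  move=> xa xb ab; rewrite -ltnS; apply: leq_trans lek; rewrite ltnS.
  apply: proper_card; apply/properP; split.
    apply/fintype.subsetP => i; rewrite !inE /merge_weights.
    by case: eqP => [->|_]; [rewrite xa|case: eqP].
  by exists b; rewrite !inE // /merge_weights eq_sym (negPf ab) eqxx.
have [le|le] := quad_merge x LC uv Lu Lv; apply: le_trans le _.
  by rewrite -(total_merge x uv) IH // small.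
by rewrite -(total_merge x vu) IH // small.
Qed.
End Zykov.

Lemma ln3_le (R : realType) : 3 * @ln R 3 <= 5 * @ln R 2.
Proof.
rewrite !mulr_natl -!lnXn // ler_ln ?posrE ?exprn_gt0 //.
by rewrite -!natrX ler_nat.
Qed.

(** This is 8 <= 9, as [ln3_le] is 27 <= 32. Together they put ln(3/2) between (ln 2)/2 and 2(ln
    2)/3, which fixes the signs of the coefficients below. *)
Lemma ln3_ge (R : realType) : 3 * @ln R 2 <= 2 * @ln R 3.
Proof.
rewrite !mulr_natl -!lnXn // ler_ln ?posrE ?exprn_gt0 //.
by rewrite -!natrX ler_nat.
Qed.

Lemma ln2_itv (R : realType) : 0 < @ln R 2 <= 1.
Proof.
rewrite ln_gt0 ?ltr1n //=.
by have := @le_ln1Dx R 1; rewrite (_ : 1 + 1 = 2) //; apply; lra.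
Qed.

Section Deterministic.
Variables (R : realType) (s q : nat) (J : finType) (W : J -> J -> nat).
Hypotheses (WC : forall x y, W x y = W y x) (Wii : forall x, W x x = 1%N)
  (W1 : forall x y, (1 <= W x y)%N)
  (Wq : forall p : 'I_s -> J, (blow_form W p <= 2 * q + s)%N).
Hypothesis q4 : (q < Sigma (graph_pattern (star 4) 2) s)%N.

Let L i j : R := ln (W i j)%:R - ln 2.
Let beta : R := ln 3 - ln 2.
Let gamma : R := ln 2.
Let supp (x : J -> nat) : pred J := fun i => (0 < x i)%N.

(** After subtracting ln 2, pairs of weight 2 vanish, pairs of weight 3 give ln(3/2) and loops give
    -ln 2; [closed_le3] excludes larger weights. *)
Lemma quad_heavy x :
  (forall i j, 0 < x i -> 0 < x j -> i != j -> 2 <= W i j)%N ->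
  log_form L x = beta * (adj_form (heavy W (supp x)) x)%:R - gamma * (sq_form x)%:R.
Proof.
move=> x2; rewrite /log_form /adj_form /sq_form !natr_sum !mulr_sumr -sumrB.
apply: eq_bigr => i _; rewrite (bigD1 i) //=.
have -> : adj_sum (heavy W (supp x)) x i =
    (\sum_(j | j != i) heavy W (supp x) i j * x j)%N.
  by rewrite /adj_sum (bigD1 i) //= heavy_irr.
rewrite !natrM natr_sum /L Wii ln1 sub0r -/gamma.
rewrite addrC mulrN [_ * gamma]mulrC; congr (_ - _).
rewrite mulr_sumr mulr_sumr; apply: eq_bigr => j ji.
rewrite natrM; have [->|xi] := posnP (x i); first by ring.
have [->|xj] := posnP (x j); first by ring.
rewrite /heavy /supp xi xj /=.
have := x2 i j xi xj; rewrite eq_sym ji => /(_ isT); have := closed_le3 WC Wii Wq q4 i j.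
case: (W i j) => [|[|[|[|//]]]] //= _ _.
  by rewrite subrr; ring.
by rewrite /beta /gamma; ring.
Qed.

Let sum_ln : \sum_i \sum_j ln (W i j)%:R = log_form L (fun=> 1%N) + #|J|%:R ^+ 2 * ln 2.
Proof.
have -> : #|J|%:R ^+ 2 * ln 2 = \sum_(i : J) \sum_(j : J) (ln 2 : R).
  by rewrite !sumr_const -mulrnA -[RHS]mulr_natl natrM expr2.
rewrite -big_split /=; apply: eq_bigr => i _; rewrite -big_split /=.
by apply: eq_bigr => j _; rewrite /L; ring.
Qed.

Let quad_le bound : (forall x, 
    (forall i j, 0 < x i -> 0 < x j -> i != j -> 2 <= W i j)%N ->
     log_form L x <= bound (total_weight x)) -> log_form L (fun=> 1%N) <= bound #|J|.
Proof.
move=> h; have := @zykov R J L W bound _ W1 _ h (fun=> 1%N).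
rewrite /total_weight sum1_card; apply.
- by move=> i j; rewrite /L WC.
- by move=> u v e; rewrite /L !Wii e.
Qed.

Lemma sum_ln_star4 :
  \sum_i \sum_j ln (W i j)%:R <=
  (6 * ln 2 + 3 * ln 3) / 10 * #|J|%:R ^+ 2 + 10 * #|J|%:R :> R.
Proof.
pose bound (t : nat) : R := (3 * beta - gamma) / 10 * t%:R ^+ 2 + 10 * t%:R.
suff : log_form L (fun=> 1%N) <= bound #|J|.
  by rewrite sum_ln /bound /beta /gamma; lra.
apply: quad_le => x x2; rewrite quad_heavy //.
set A := heavy _ _.
have Asym : symmetric A by exact: heavy_sym.
have Airr : irreflexive A by exact: heavy_irr.
have deg i : (#|[pred j | A i j]| <= 3)%N by rewrite -ltnS; exact: (heavy_deg WC Wii Wq x2).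
have h1 := adj_form_deg Asym x deg.
have h2 := adj_form_girth5 Asym Airr deg (heavy_noC3 WC Wii Wq q4)
  (heavy_noC4 WC Wii Wq x2 q4) x.
move: h1 h2; rewrite -!(ler_nat R) !natrD !natrM /bound.
have : 0 <= (total_weight x)%:R :> R by [].
move: (adj_form _ _)%:R (sq_form x)%:R (total_weight x)%:R => e f t t0 h1 h2.
have i3 := ln3_le R; have i2 := ln3_ge R; have /andP[l0 l1] := ln2_itv R.
(* beta e - gamma f = ((gamma - beta)/2)(e - 3f) + ((3 beta - gamma)/10)(5e - 5f). *)
have h3 : 0 <= (gamma - beta) * (3 * f - e) by apply: mulr_ge0; rewrite /gamma /beta; lra.
have h4 : 0 <= (3 * beta - gamma) * (t * t + 10 * t + 5 * f - 5 * e).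
  by apply: mulr_ge0; rewrite /gamma /beta; lra.
have h5 : 0 <= (1 - gamma) * t by rewrite mulr_ge0 // subr_ge0; exact: l1.
have h6 : 0 <= (gamma - beta) * t by rewrite mulr_ge0 // /gamma /beta; lra.
by lra.
Qed.

Lemma sum_ln_star3 : (q < Sigma (graph_pattern (star 3) 2) s)%N ->
  \sum_i \sum_j ln (W i j)%:R <=
  (3 * ln 2 + 2 * ln 3) / 6 * #|J|%:R ^+ 2 + 10 * #|J|%:R :> R.
Proof.
move=> q3.
pose bound (t : nat) : R := (2 * beta - gamma) / 6 * t%:R ^+ 2 + 10 * t%:R.
suff : log_form L (fun=> 1%N) <= bound #|J|.
  by rewrite sum_ln /bound /beta /gamma; lra.
apply: quad_le => x x2; rewrite quad_heavy //.
set A := heavy _ _.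
have Asym : symmetric A by exact: heavy_sym.
have Airr : irreflexive A by exact: heavy_irr.
have deg i : (#|[pred j | A i j]| <= 2)%N by rewrite -ltnS; exact: (heavy_deg WC Wii Wq x2).
have h1 := adj_form_deg Asym x deg.
have h2 := adj_form_girth6 Asym Airr deg (heavy_noC3 WC Wii Wq q4)
  (heavy_noC4 WC Wii Wq x2 q4) (heavy_noC5 WC Wii Wq x2 q4 q3) x.
move: h1 h2; rewrite -!(ler_nat R) !natrD !natrM /bound.
have : 0 <= (total_weight x)%:R :> R by [].
move: (adj_form _ _)%:R (sq_form x)%:R (total_weight x)%:R => e f t t0 h1 h2.
have i3 := ln3_le R; have i2 := ln3_ge R; have /andP[l0 l1] := ln2_itv R.
(* beta e - gamma f = (gamma - beta)(e - 2f) + ((2 beta - gamma)/6)(6e - 6f). *)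
have h3 : 0 <= (gamma - beta) * (2 * f - e) by apply: mulr_ge0; rewrite /gamma /beta; lra.
have h4 : 0 <= (2 * beta - gamma) * (t * t + 12 * t + 6 * f - 6 * e).
  by apply: mulr_ge0; rewrite /gamma /beta; lra.
have h5 : 0 <= (1 - gamma) * t by rewrite mulr_ge0 // subr_ge0; exact: l1.
have h6 : 0 <= (gamma - beta) * t by rewrite mulr_ge0 // /gamma /beta; lra.
by lra.
Qed.

Lemma sum_ln_path4 : (q < Sigma (graph_pattern (star 3) 2) s)%N ->
  (q < Sigma (graph_pattern path4 2) s)%N ->
  \sum_i \sum_j ln (W i j)%:R <= ln 2 * #|J|%:R ^+ 2 :> R.
Proof.
move=> q3 qP.
suff : log_form L (fun=> 1%N) <= 0 by rewrite sum_ln; lra.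
apply: (@quad_le (fun=> 0)) => x x2; rewrite quad_heavy //.
set A := heavy _ _.
have Asym : symmetric A by exact: heavy_sym.
have Airr : irreflexive A by exact: heavy_irr.
have deg i : (#|[pred j | A i j]| <= 2)%N by rewrite -ltnS; exact: (heavy_deg WC Wii Wq x2).
have := adj_form_P4free Asym Airr deg (heavy_noC3 WC Wii Wq q4)
  (heavy_noP4 WC Wii Wq x2 qP) x.
rewrite -!(ler_nat R) !natrM.
have : 0 <= (sq_form x)%:R :> R by [].
move: (adj_form _ _)%:R (sq_form x)%:R => e f f0 h.
have i3 := ln3_le R; have i2 := ln3_ge R; have /andP[l0 l1] := ln2_itv R.
have h3 : 0 <= beta * (3 * f - 2 * e) by apply: mulr_ge0; rewrite /beta; lra.
have h4 : 0 <= (2 * gamma - 3 * beta) * f by apply: mulr_ge0; rewrite /gamma /beta; lra.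
by lra.
Qed.
End Deterministic.

(** * Upper bound *)

Lemma ln_prod_nat (R : realType) (I : finType) (P : pred I) (F : I -> nat) :
  (forall i, P i -> 0 < F i)%N ->
  ln (\prod_(i | P i) F i)%N%:R = \sum_(i | P i) ln (F i)%:R :> R.
Proof.
move=> F0.
suff : ln (\prod_(i | P i) F i)%N%:R = \sum_(i | P i) ln (F i)%:R :> R /\
  (0 < \prod_(i | P i) F i)%N by case.
elim/big_rec2: _ => [|i y1 y2 Pi [<- y0]]; first by rewrite ln1.
by rewrite muln_gt0 F0 // natrM lnM ?posrE ?ltr0n ?F0.
Qed.

Lemma ln_mg_prod (R : realType) (V : finType) (w : multigraph V) :
  (0 < mg_prod w)%N -> 2 * ln (mg_prod w)%:R = \sum_i \sum_j ln (wt w i j)%:R :> R.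
Proof.
move=> P0.
have w0 (A : {set V}) : #|A| == 2%N -> (0 < w A)%N.
  by move=> A2; move: P0; rewrite /mg_prod (bigD1 A) //= muln_gt0 => /andP[].
rewrite ln_prod_nat //.
have := @big_pairs R 0 +%R V (fun A => ln (w A)%:R) [set: V]%SET.
rewrite (eq_bigl (fun A : {set V} => #|A| == 2%N)) => [|A]; last by rewrite finset.subsetT.
rewrite mulr_natl mulr2n => <-.
apply: eq_big => [i|i _]; first by rewrite !inE.
rewrite [RHS](bigD1 i) //= wtii ln1 add0r.
apply: eq_big => [j|j /andP[_ ji]]; first by rewrite !inE.
by rewrite /wt eq_sym (negPf ji).
Qed.

Lemma wt_gt0 (V : finType) (w : multigraph V) i j :
  (0 < mg_prod w)%N -> (0 < wt w i j)%N.
Proof.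
rewrite /wt; case: eqP => // /eqP ij.
by rewrite /mg_prod (bigD1 [set i; j]%SET) /= ?cards2 ?ij // muln_gt0 => /andP[].
Qed.

Lemma sq_graph_wt_le (V : finType) (w : multigraph V) s q i j :
  (2 <= s <= #|V|)%N -> sq_graph s q w -> i != j -> (w [set i; j]%SET <= q)%N.
Proof.
move=> /andP[s2 sV] sqw ij.
(* With [i] and [j] listed first, the first s >= 2 entries form an s-set containing both. *)
pose l := [:: i; j] ++ [seq x <- enum V | x \notin [:: i; j]].
have ul : uniq l.
  rewrite cat_uniq filter_uniq ?enum_uniq // andbT [uniq _]/= inE ij /=.
  by apply/hasPn => x; rewrite mem_filter => /andP[].
have sl : (#|V| <= size l)%N.
  apply: leq_trans (card_size l); apply/subset_leq_card/fintype.subsetP => x _.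
  by rewrite mem_cat mem_filter mem_enum andbT orbN.
pose X := [set x in take s l]%SET.
have cX : #|X| = s.
  by rewrite cardsE (card_uniqP _) ?take_uniq // size_takel // (leq_trans sV).
apply: leq_trans (sqw _ cX); rewrite /mg_sum (bigD1 [set i; j]%SET) ?leq_addr //=.
rewrite cards2 ij andbT finset.subUset !finset.sub1set !inE /l.
by case: s s2 {sV sqw X cX} => [|[|s]] //= _; rewrite !inE !eqxx orbT.
Qed.

Section Upper.
Variables (R : realType) (s q : nat) (c : R).
Hypotheses (s2 : (2 <= s)%N) (c0 : 0 <= c).
Hypothesis Det : forall (J : finType) (W : J -> J -> nat),
  (forall x y, W x y = W y x) -> (forall x, W x x = 1%N) ->
  (forall x y, (1 <= W x y)%N) ->
  (forall p : 'I_s -> J, (blow_form W p <= 2 * q + s)%N) ->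
  \sum_i \sum_j ln (W i j)%:R <= c * #|J|%:R ^+ 2 + 10 * #|J|%:R.

Lemma sum_pair_sample (J V : finType) (a b : J) (g : V -> V -> R) : a != b ->
  #|V|%:R ^+ 2 * \sum_(Phi : {ffun J -> V}) g (Phi a) (Phi b) =
  #|{ffun J -> V}|%:R * \sum_x \sum_y g x y.
Proof.
move=> ab; rewrite expr2 -mulrA -(sum_resample a) -(sum_resample b).
rewrite -sum1_card natr_sum mulr_suml; apply: eq_bigr => Phi _.
rewrite mul1r exchange_big /=; apply: eq_bigr => x _; apply: eq_bigr => y _.
by rewrite !ffunE eqxx eq_sym (negPf ab) eqxx.
Qed.

(** The maximum with 1 covers the diagonal weights and keeps ln Q nonnegative. *)
Let Q := maxn 1 q.

(** Average [T Phi], the log sum of the pull-back along [Phi]. Off-diagonal pairs are sent to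
    uniform pairs, so the mean is m(m - 1)/n^2 times the sum to be bounded. A [Phi] with no bad [f]
    obeys [Det]; the expected number of bad [f] is at most 1/m, so the trivial bound m^2 ln Q costs
    only m ln Q. *)
Lemma sum_ln_wt_le (m n : nat) (w : multigraph 'I_n) :
  (s <= n)%N -> sq_graph s q w -> (0 < mg_prod w)%N -> (0 < m)%N ->
  (forall f : {ffun 'I_s -> 'I_m},
    \sum_(Phi : {ffun 'I_m -> 'I_n}) (2 * q + s < blow_form (wt w) (Phi \o f))%N%:R
      <= (m%:R * #|{ffun 'I_s -> 'I_m}|%:R)^-1 * #|{ffun 'I_m -> 'I_n}|%:R :> R) ->
  m.-1%:R * \sum_i \sum_j ln (wt w i j)%:R <= n%:R ^+ 2 * (c * m%:R + 10 + ln Q%:R) :> R.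
Proof.
move=> sn sqw P0 m0 few.
set Ltot := \sum_i \sum_j _.
set N : R := #|{ffun 'I_m -> 'I_n}|%:R in few *.
set F : R := #|{ffun 'I_s -> 'I_m}|%:R in few *.
pose T (Phi : {ffun 'I_m -> 'I_n}) : R := \sum_a \sum_b ln (wt w (Phi a) (Phi b))%:R.
have mR : 0 < m%:R :> R by rewrite ltr0n.
have n0 : (0 < n)%N by apply: leq_trans sn; apply: leq_trans s2.
have N0 : 0 < N.
  by rewrite ltr0n; apply/card_gt0P; exists [ffun=> Ordinal n0].
have F0 : 0 < F.
  by rewrite ltr0n; apply/card_gt0P; exists [ffun=> Ordinal m0].
have avg : n%:R ^+ 2 * \sum_Phi T Phi = N * (m%:R * (m.-1%:R * Ltot)).
  rewrite /T exchange_big /= mulr_sumr.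
  rewrite (eq_bigr (fun=> N * (m.-1%:R * Ltot))).
    by rewrite sumr_const card_ord [RHS]mulrCA [RHS]mulr_natl.
  move=> a _; rewrite exchange_big /= (bigD1 a) //= [X in X + _]big1 ?add0r.
    rewrite mulr_sumr (eq_bigr (fun=> N * Ltot)).
      by rewrite sumr_const cardC1 card_ord [RHS]mulrCA [RHS]mulr_natl.
    move=> b ba; have := @sum_pair_sample 'I_m 'I_n a b (fun x y => ln (wt w x y)%:R).
    by rewrite card_ord eq_sym => ->.
  by move=> Phi _; rewrite wtii ln1.
have lnQ : 0 <= ln Q%:R :> R by rewrite ln_ge0 // ler1n leq_max.
have TQ Phi : T Phi <= m%:R ^+ 2 * ln Q%:R.
  apply: (@le_trans _ _ (\sum_(a < m) \sum_(b < m) ln Q%:R)); last first.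
    by rewrite !sumr_const card_ord -mulrnA -[_ *+ (_ * _)]mulr_natl natrM expr2.
  apply: ler_sum => a _; apply: ler_sum => b _.
  rewrite ler_ln ?posrE ?ltr0n ?wt_gt0 ?leq_max // ler_nat /wt.
  case: eqP => [_|/eqP ne]; first by rewrite leq_max.
  by rewrite leq_max (sq_graph_wt_le _ sqw) ?orbT // s2 card_ord.
pose bad (f : {ffun 'I_s -> 'I_m}) (Phi : {ffun 'I_m -> 'I_n}) : R :=
  (2 * q + s < blow_form (wt w) (Phi \o f))%N%:R.
have Tle Phi : T Phi <= (c * m%:R ^+ 2 + 10 * m%:R) + m%:R ^+ 2 * ln Q%:R * \sum_f bad f Phi.
  have [/existsP[f fbad]|nobad] := boolP [exists f : {ffun 'I_s -> 'I_m},
      (2 * q + s < blow_form (wt w) (Phi \o f))%N].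
    apply: le_trans (TQ Phi) _.
    rewrite -[leLHS]add0r lerD //.
      by rewrite addr_ge0 ?mulr_ge0 ?exprn_ge0.
    rewrite ler_peMr ?mulr_ge0 ?exprn_ge0 // (bigD1 f) //= /bad fbad.
    by rewrite lerDl sumr_ge0.
  rewrite -[leLHS]addr0 lerD //; last by rewrite !mulr_ge0 ?exprn_ge0 ?sumr_ge0.
  have := @Det 'I_m (fun a b => wt w (Phi a) (Phi b)); rewrite card_ord; apply.
  - by move=> *; rewrite wtC.
  - by move=> *; rewrite wtii.
  - by move=> *; rewrite wt_gt0.
  move=> p; rewrite leqNgt; apply: contra nobad => lt; apply/existsP.
  exists (finfun p); apply: leq_trans lt _; apply: eq_leq.
  by apply: eq_bigr => a _; apply: eq_bigr => b _; rewrite /= !ffunE.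
have sumT : \sum_Phi T Phi <= N * (m%:R * (c * m%:R + 10 + ln Q%:R)).
  apply: le_trans (ler_sum _ (fun Phi _ => Tle Phi)) _.
  rewrite big_split /= sumr_const -mulr_sumr exchange_big /=.
  have badF : \sum_f \sum_Phi bad f Phi <= m%:R^-1 * N.
    apply: (@le_trans _ _ (\sum_(f : {ffun 'I_s -> 'I_m}) (m%:R * F)^-1 * N)).
      by apply: ler_sum => f _; exact: few.
    rewrite sumr_const -[leLHS]mulr_natl -/F (_ : F * _ = m%:R^-1 * N) //.
    by field; rewrite !gt_eqF.
  rewrite -mulr_natl -/N.
  have : m%:R ^+ 2 * ln Q%:R * \sum_f \sum_Phi bad f Phi <=
         m%:R ^+ 2 * ln Q%:R * (m%:R^-1 * N).
    by rewrite ler_wpM2l // mulr_ge0 // exprn_ge0.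
  rewrite (_ : m%:R ^+ 2 * ln Q%:R * (m%:R^-1 * N) = N * (m%:R * ln Q%:R)); last first.
    by field; rewrite gt_eqF.
  by move=> h; lra.
rewrite -(ler_pM2l mR) -(ler_pM2l N0) -avg.
rewrite [m%:R * (n%:R ^+ 2 * _)]mulrCA [N * (n%:R ^+ 2 * _)]mulrCA.
by rewrite ler_wpM2l // exprn_ge0.
Qed.

Lemma bin2_natr n : 'C(n, 2)%:R * 2 = n%:R * (n%:R - 1) :> R.
Proof.
case: n => [|n]; first by rewrite mul0r mul0r.
by rewrite -natrM -[2%N]/(2`!)%N bin_ffact ffactnS ffactn1 /= natrM -[n.+1%:R]natr1 addrK.
Qed.

Lemma mg_prod_upper (eps : R) : 0 < eps -> exists N : nat, forall n, (N <= n)%N ->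
  forall w : multigraph 'I_n, sq_graph s q w -> (0 < mg_prod w)%N ->
  ln (mg_prod w)%:R <= 'C(n, 2)%:R * (c + eps) :> R.
Proof.
move=> eps0; pose e2 := eps / 2.
have e20 : 0 < e2 by rewrite divr_gt0.
have lnQ : 0 <= ln Q%:R :> R by rewrite ln_ge0 // ler1n leq_max.
pose K : R := c + 10 + ln Q%:R.
have K0 : 0 <= K by rewrite !addr_ge0.
(* Large enough that the linear error K, divided by m - 1, is at most eps/2; the other half pays for
   n^2 against n(n - 1). *)
pose m := (maxn s (Num.bound (K / e2))).+1.
have mK : K <= e2 * m.-1%:R.
  rewrite mulrC -ler_pdivrMr //; apply: ltW; apply: lt_le_trans (archi_boundP _) _.
    by rewrite divr_ge0 // ltW.
  by rewrite ler_nat leq_maxr.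
have m1 : 0 < m.-1%:R :> R by rewrite ltr0n leq_max (leq_trans _ s2).
have d0 : 0 < (m%:R * #|{ffun 'I_s -> 'I_m}|%:R)^-1 :> R.
  by rewrite invr_gt0 mulr_gt0 ?ltr0n //; apply/card_gt0P; exists [ffun=> ord0].
have sm : (s <= m)%N by rewrite leqW // leq_maxl.
have [N HN] : exists N : nat, forall n, (N <= n)%N -> forall w : multigraph 'I_n,
    sq_graph s q w -> (0 < mg_prod w)%N -> forall f : {ffun 'I_s -> 'I_m},
    \sum_(Phi : {ffun 'I_m -> 'I_n}) (2 * q + s < blow_form (wt w) (Phi \o f))%N%:R
      <= (m%:R * #|{ffun 'I_s -> 'I_m}|%:R)^-1 * #|{ffun 'I_m -> 'I_n}|%:R :> R.
  have /choice[Nf HNf] := fun f : {ffun 'I_s -> 'I_m} => few_blow_ups q sm f d0.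
  exists (\max_f Nf f)%N => n Nn w sqw P0 f.
  apply: HNf => //; first by apply: leq_trans Nn; apply: leq_bigmax.
  by move=> i j; rewrite wt_gt0.
exists (maxn N (maxn s (Num.bound ((c + eps) / e2)))) => n.
rewrite !geq_max => /and3P[Nn sn bn] w sqw P0.
have h := @sum_ln_wt_le m n w sn sqw P0 isT (HN n Nn w sqw P0).
rewrite -ln_mg_prod // in h.
have nR : (c + eps) <= e2 * n%:R.
  rewrite mulrC -ler_pdivrMr //; apply: ltW; apply: lt_le_trans (archi_boundP _) _.
    by rewrite divr_ge0 ?addr_ge0 // ltW.
  by rewrite ler_nat.
have n2 : 0 <= n%:R :> R by [].
have h2 : 2 * ln (mg_prod w)%:R <= n%:R ^+ 2 * (c + e2).
  rewrite -(ler_pM2l m1); apply: le_trans h _; rewrite mulrCA ler_wpM2l ?exprn_ge0 //.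
  rewrite -[m]/(m.-1.+1) -natr1 /K in mK *; lra.
suff : 2 * ln (mg_prod w)%:R <= 'C(n, 2)%:R * 2 * (c + eps) by lra.
rewrite bin2_natr; apply: le_trans h2 _.
have : 0 <= n%:R * (e2 * n%:R - (c + eps)) by rewrite mulr_ge0 // subr_ge0.
by rewrite /e2; lra.
Qed.
End Upper.

(** * Lower bound *)

(** Some colour for vertex n does at least as well as the average, n rho. Over ordered pairs this
    adds 2n rho, and n(n - 1) + 2n = (n + 1)n; the new diagonal term is 0. *)
Lemma greedy_colouring (R : realType) (T : eqType) (col : seq T) (lw : T -> T -> R)
    (rho : R) :
  (0 < size col)%N -> (forall c c', lw c c' = lw c' c) ->
  {in col, forall c, lw c c = 0} ->
  {in col, forall c', (size col)%:R * rho <= \sum_(c <- col) lw c c'} ->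
  forall n, exists2 f : nat -> T, forall i, f i \in col &
    n%:R * (n%:R - 1) * rho <= \sum_(i < n) \sum_(j < n) lw (f i) (f j).
Proof.
move=> col0 lwC lw0 avg; elim=> [|n [f fcol IH]].
  have [c0 c0P] : exists c0, c0 \in col.
    by case: col col0 {lw0 avg} => // c0 col _; exists c0; rewrite inE eqxx.
  by exists (fun=> c0); rewrite // big_ord0 !mul0r.
have [c cP le] : exists2 c, c \in col & n%:R * rho <= \sum_(i < n) lw c (f i).
  have [/hasP[c cP le]|/hasPn no] :=
      boolP (has (fun c => n%:R * rho <= \sum_(i < n) lw c (f i)) col).
    by exists c.
  exfalso.
  have : \sum_(c <- col) \sum_(i < n) lw c (f i) < \sum_(c <- col) n%:R * rho.
    rewrite !big_seq; apply: ltr_sum; last by move=> c /no; rewrite -ltNge.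
    by case: col col0 {no lw0 avg fcol} => // c0 col _ /=; rewrite inE eqxx.
  rewrite exchange_big /= ltNge => /negP; apply.
  rewrite big_const_seq count_predT iter_addr addr0 -[leLHS]mulr_natl mulrCA.
  rewrite mulr_natl -[X in _ *+ X](card_ord n) -sumr_const.
  by apply: ler_sum => i _; apply: avg.
pose g i := if (i < n)%N then f i else c.
exists g => [i|]; first by rewrite /g; case: ifP.
rewrite big_ord_recr /=.
rewrite (eq_bigr (fun i : 'I_n => \sum_(j < n) lw (f i) (f j) + lw c (f i))); last first.
  move=> i _; rewrite big_ord_recr /= {1 3}/g ltn_ord {2}/g ltnn [lw (f i) c]lwC.
  by congr (_ + _); apply: eq_bigr => j _; rewrite /g !ltn_ord.
rewrite big_split /= big_ord_recr /= {3 4}/g ltnn lw0 // addr0.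
rewrite [X in _ + _ + X](eq_bigr (fun i : 'I_n => lw c (f i))); last first.
  by move=> i _; rewrite /g ltnn ltn_ord.
rewrite -natr1; lra.
Qed.

(** The normalised logarithms of the suprema are squeezed between c and c + eps, and exp is
    continuous. For n >= s all pair weights are at most q, so the supremum is of a bounded set. *)
Lemma exPi_root_cvg (R : realType) (s q : nat) (c : R) : (2 <= s)%N ->
  (forall n, exists w : multigraph 'I_n, [/\ sq_graph s q w, (0 < mg_prod w)%N &
     'C(n, 2)%:R * c <= ln (mg_prod w)%:R]) ->
  (forall eps : R, 0 < eps -> exists N : nat, forall n, (N <= n)%N ->
    forall w : multigraph 'I_n, sq_graph s q w -> (0 < mg_prod w)%N ->
    ln (mg_prod w)%:R <= 'C(n, 2)%:R * (c + eps)) ->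
  (exPi_root R s q n @[n --> \oo] --> expR c)%classic.
Proof.
move=> s2 lower upper.
have ub n : (s <= n)%N -> forall w : multigraph 'I_n, sq_graph s q w ->
    (mg_prod w)%:R <= exPi_n R n s q.
  move=> sn w sqw; apply: ub_le_sup; last by exists w.
  exists (\prod_(A : {set 'I_n} | #|A| == 2%N) q)%N%:R => _ [w' sqw' <-].
  rewrite ler_nat; apply: leq_prod => A /cards2P[i [j [ij ->]]].
  by apply: (sq_graph_wt_le _ sqw'); rewrite // s2 card_ord.
have pos n : (s <= n)%N -> 0 < exPi_n R n s q.
  move=> sn; have [w [sqw P0 _]] := lower n.
  by apply: lt_le_trans (ub n sn w sqw); rewrite ltr0n.
have C0 n : (s <= n)%N -> 0 < 'C(n, 2)%:R :> R.
  by move=> sn; rewrite ltr0n bin_gt0 (leq_trans s2).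
have cvg : ((('C(n, 2)%:R)^-1 * ln (exPi_n R n s q)) @[n --> \oo] --> c)%classic.
  apply/cvgrPdist_le => eps eps0; have [N HN] := upper eps eps0.
  exists (maxn N s) => // n /=; rewrite geq_max => /andP[Nn sn].
  rewrite distrC ler_norml; apply/andP; split.
    rewrite -subr_ge0 opprK; apply: (@le_trans _ _ eps); first exact: ltW.
    rewrite lerDr subr_ge0 mulrC ler_pdivlMr ?C0 // mulrC.
    have [w [sqw P0 le]] := lower n; apply: le_trans le _.
    by rewrite ler_ln ?posrE ?ltr0n ?pos // ub.
  rewrite lerBlDl mulrC ler_pdivrMr ?C0 // mulrC.
  rewrite -ler_expR lnK ?posrE ?pos //; apply: ge_sup.
    have [w [sqw _ _]] := lower n; by exists (mg_prod w)%:R, w.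
  (* A zero product has no meaningful logarithm; positivity of exp covers it. *)
  move=> _ [w sqw <-]; have [->|P0] := posnP (mg_prod w); first exact: expR_ge0.
  by rewrite -[leLHS]lnK ?posrE ?ltr0n // ler_expR HN.
have h := @continuous_cvg _ _ _ _ eventually_filter _ _ _ (@continuous_expR R c) cvg.
have e : {near \oo, (fun n => expR (('C(n, 2)%:R)^-1 * ln (exPi_n R n s q)))
    =1 exPi_root R s q}%classic.
  by exists s => // n /= sn; rewrite /exPi_root /powR gt_eqF ?pos.
by apply: cvg_trans h; apply: near_eq_cvg.
Qed.

(* Colours are the 2-subsets of {0,..,4}, i.e. the vertices of the Petersen
   graph; [3 - shared c c'] is its pattern, loops included. *)
Definition has_elt (c : nat * nat) (k : nat) : bool := (k == c.1) || (k == c.2).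

Definition shared (c c' : nat * nat) : nat :=
  \sum_(k < 5) (has_elt c k && has_elt c' k).

Definition petersen : seq (nat * nat) :=
  [:: (0, 1); (0, 2); (0, 3); (0, 4); (1, 2); (1, 3); (1, 4); (2, 3); (2, 4); (3, 4)]%N.

Definition hexagon : seq (nat * nat) :=
  [:: (0, 3); (0, 4); (1, 3); (1, 4); (2, 3); (2, 4)]%N.

(** Quantifying over the members of [A] counts the elements common to all their colours without
    ordering the pair. For colours in [petersen] at most two are shared, so the subtraction is not
    truncated. *)
Definition colour_graph n (f : nat -> nat * nat) : multigraph 'I_n :=
  fun A => (3 - \sum_(k < 5) [forall i in A, has_elt (f i) k])%N.

Lemma colour_graph2 n f (i j : 'I_n) :
  colour_graph f [set i; j]%SET = (3 - shared (f i) (f j))%N.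
Proof.
rewrite /colour_graph /shared; congr (3 - _)%N; apply: eq_bigr => k _; congr nat_of_bool.
apply/forall_inP/andP => [h|[hi hj] x].
  by split; apply: h; rewrite !inE eqxx ?orbT.
by rewrite !inE => /orP[] /eqP ->.
Qed.

Lemma sharedE c c' : shared c c' =
  ((has_elt c 0 && has_elt c' 0) + (has_elt c 1 && has_elt c' 1) +
   (has_elt c 2 && has_elt c' 2) + (has_elt c 3 && has_elt c' 3) +
   (has_elt c 4 && has_elt c' 4))%N.
Proof. by rewrite /shared !big_ord_recr big_ord0. Qed.

Lemma sharedC c c' : shared c c' = shared c' c.
Proof. by apply: eq_bigr => k _; rewrite andbC. Qed.

Lemma shared_le2 c c' : c \in petersen -> (shared c c' <= 2)%N.
Proof.
move=> cP.
apply: (@leq_trans (\sum_(k < 5) has_elt c k)); last first.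
  rewrite !big_ord_recr big_ord0 /=.
  by have /allP/(_ c cP) : all (fun c => 0 + has_elt c 0 + has_elt c 1 +
    has_elt c 2 + has_elt c 3 + has_elt c 4 <= 2)%N petersen by [].
by apply: leq_sum => k _; case: (has_elt c k) => //; case: (has_elt c' k).
Qed.

Lemma shared_id c : c \in petersen -> shared c c = 2%N.
Proof.
move=> cP; rewrite sharedE !andbb; apply/eqP.
by have /allP/(_ c cP) : all (fun c => has_elt c 0 + has_elt c 1 +
  has_elt c 2 + has_elt c 3 + has_elt c 4 == 2)%N petersen by [].
Qed.

Section Lower.
Variables (R : realType) (col : seq (nat * nat)).
Hypothesis colP : {subset col <= petersen}.

Lemma colour_graph_wt n f (i j : 'I_n) : (forall i, f i \in col) ->
  wt (colour_graph f) i j = (3 - shared (f i) (f j))%N.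
Proof.
move=> fcol; rewrite /wt; case: eqP => [->|_]; last exact: colour_graph2.
by rewrite shared_id // colP.
Qed.

(** Double counting of triples (i, j, k) with [k] in the colours of both [i] and [j]. *)
Lemma colour_graph_sum n f (X : {set 'I_n}) : (forall i, f i \in col) ->
  (2 * mg_sum (colour_graph f) X + #|X| +
   \sum_(k < 5) (\sum_(i in X) has_elt (f i) k) * (\sum_(i in X) has_elt (f i) k) =
   3 * (#|X| * #|X|))%N.
Proof.
move=> fcol; rewrite mg_sum_wt.
have -> : (\sum_(k < 5) (\sum_(i in X) has_elt (f i) k) * (\sum_(i in X) has_elt (f i) k)
    = \sum_(i in X) \sum_(j in X) shared (f i) (f j))%N.
  rewrite /shared; under [RHS]eq_bigr do rewrite exchange_big /=.
  rewrite exchange_big /=; apply: eq_bigr => k _; rewrite big_distrl /=.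
  apply: eq_bigr => i _; rewrite big_distrr /=; apply: eq_bigr => j _.
  by rewrite mulnb.
rewrite -big_split /= (eq_bigr (fun=> 3 * #|X|)%N).
  by rewrite sum_nat_const mulnCA.
move=> i _; rewrite -big_split /= (eq_bigr (fun=> 3)%N).
  by rewrite sum_nat_const mulnC.
move=> j _; rewrite colour_graph_wt // subnK //.
by rewrite (leq_trans (shared_le2 _ _)) // colP.
Qed.

(** [vals] is the multiset of weights seen from a colour, the same for every colour by symmetry;
    [rho] is the mean of its logarithms. The number of shared elements is written out so that the
    check is by computation. *)
Lemma colour_graph_lower (vals : seq nat) (rho : R) n :
  (0 < size col)%N ->
  all (fun c' => perm_eq [seq 3 -
      ((has_elt c 0 && has_elt c' 0) + (has_elt c 1 && has_elt c' 1) +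
       (has_elt c 2 && has_elt c' 2) + (has_elt c 3 && has_elt c' 3) +
       (has_elt c 4 && has_elt c' 4)) | c <- col]%N vals) col ->
  (size col)%:R * rho = \sum_(v <- vals) ln v%:R ->
  exists f : nat -> nat * nat, [/\ forall i, f i \in col,
    (0 < mg_prod (@colour_graph n f))%N &
    'C(n, 2)%:R * rho <= ln (mg_prod (@colour_graph n f))%:R].
Proof.
move=> col0 /allP prof rhoE.
have [||c' c'P|f fcol le] :=
   @greedy_colouring R _ col (fun c c' => ln (3 - shared c c')%N%:R) rho col0 _ _ _ n.
- by move=> c c'; rewrite sharedC.
- by move=> c cP; rewrite shared_id ?ln1 // colP.
- rewrite rhoE -(perm_big _ (prof _ c'P)) big_map.
  by apply: ler_sum => c _; rewrite sharedE.
have P0 : (0 < mg_prod (@colour_graph n f))%N.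
  rewrite /mg_prod prodn_cond_gt0 // => A /cards2P[i [j [_ ->]]].
  by rewrite colour_graph2 subn_gt0 ltnS shared_le2 // colP.
exists f; split=> //.
suff : 'C(n, 2)%:R * 2 * rho <= 2 * ln (mg_prod (@colour_graph n f))%:R by lra.
rewrite bin2_natr ln_mg_prod //; apply: le_trans le _.
by apply: ler_sum => i _; apply: ler_sum => j _; rewrite colour_graph_wt.
Qed.
End Lower.

(** The counts T_k add up to 2s, so their squares add up to at least 4s^2/5, leaving density 3 - 4/5
    = 11/5; the remainder 9 < 10 in [Sigma_star3_ge] is removed by integrality. *)
Lemma colour_graph_petersen s q n (f : nat -> nat * nat) :
  (Sigma (graph_pattern (star 3) 2) s <= q)%N ->
  (forall i, f i \in petersen) -> sq_graph s q (@colour_graph n f).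
Proof.
move=> qs fP X Xs; have := colour_graph_sum (col := petersen) (fun c cP => cP) X fP.
pose t k := (\sum_(i in X) has_elt (f i) k)%N.
have tS : (t 0 + t 1 + t 2 + t 3 + t 4 = 2 * s)%N.
  rewrite /t -!big_split /= (eq_bigr (fun=> 2%N)) => [|i _].
    by rewrite sum_nat_const Xs mulnC.
  by have := shared_id (fP i); rewrite sharedE !andbb.
rewrite !big_ord_recr big_ord0 /= -/(t 0) -/(t 1) -/(t 2) -/(t 3) -/(t 4) Xs add0n.
have := Sigma_star3_ge s.
move: (t 0) (t 1) (t 2) (t 3) (t 4) tS (mg_sum _ X) qs => t0 t1 t2 t3 t4 tS e qs h1 h2.
have sq5 : (4 * (s * s) <= 5 * (t0 * t0 + t1 * t1 + t2 * t2 + t3 * t3 + t4 * t4))%N.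
  have : ((t0 + t1 + t2 + t3 + t4) * (t0 + t1 + t2 + t3 + t4) <=
      5 * (t0 * t0 + t1 * t1 + t2 * t2 + t3 * t3 + t4 * t4))%N.
    have := (double_mul_le t0 t1, double_mul_le t0 t2, double_mul_le t0 t3,
      double_mul_le t0 t4, double_mul_le t1 t2, double_mul_le t1 t3,
      double_mul_le t1 t4, double_mul_le t2 t3, double_mul_le t2 t4, double_mul_le t3 t4).
    by clear; case=> [[[[[[[[[]]]]]]]]] *; lia.
  by rewrite tS; apply: leq_trans; lia.
by move: qs h1 h2 sq5; clear; lia.
Qed.

(** Here T_0 + T_1 + T_2 = s and T_3 + T_4 = s, so the density is at most 3 - 1/3 - 1/2 = 13/6, and
    11 < 12 allows rounding. *)
Lemma colour_graph_hexagon s q n (f : nat -> nat * nat) :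
  (Sigma (graph_pattern path4 2) s <= q)%N ->
  (forall i, f i \in hexagon) -> sq_graph s q (@colour_graph n f).
Proof.
move=> qs fP X Xs.
have hP : {subset hexagon <= petersen} by apply/allP.
have := colour_graph_sum hP X fP.
pose t k := (\sum_(i in X) has_elt (f i) k)%N.
have tS : (t 0 + t 1 + t 2 = s)%N.
  rewrite /t -!big_split /= (eq_bigr (fun=> 1%N)) => [|i _].
    by rewrite sum1_card.
  by apply/eqP; have /allP/(_ _ (fP i)) : all (fun c =>
    has_elt c 0 + has_elt c 1 + has_elt c 2 == 1)%N hexagon by [].
have tS' : (t 3 + t 4 = s)%N.
  rewrite /t -!big_split /= (eq_bigr (fun=> 1%N)) => [|i _].
    by rewrite sum1_card.
  by apply/eqP; have /allP/(_ _ (fP i)) : all (fun c =>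
    has_elt c 3 + has_elt c 4 == 1)%N hexagon by [].
rewrite !big_ord_recr big_ord0 /= -/(t 0) -/(t 1) -/(t 2) -/(t 3) -/(t 4) Xs add0n.
have := Sigma_path4_ge s.
move: (t 0) (t 1) (t 2) (t 3) (t 4) tS tS' (mg_sum _ X) qs.
move=> t0 t1 t2 t3 t4 tS tS' e qs h1 h2.
have sq3 : (s * s <= 3 * (t0 * t0 + t1 * t1 + t2 * t2))%N.
  have := (double_mul_le t0 t1, double_mul_le t0 t2, double_mul_le t1 t2).
  by rewrite -tS; clear; case=> [[]] *; lia.
have sq2 : (s * s <= 2 * (t3 * t3 + t4 * t4))%N.
  have := double_mul_le t3 t4.
  by rewrite -tS'; clear; lia.
by move: qs h1 h2 sq3 sq2; clear; lia.
Qed.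

(** P_4 is not a subgraph of K_{1,3}, so the comparison is numerical: 13/6 < 11/5, with a rounding
    error below 1. *)
Lemma Sigma_path4_le_star3 s :
  (Sigma (graph_pattern path4 2) s <= Sigma (graph_pattern (star 3) 2) s)%N.
Proof. by have := Sigma_path4_le s; have := Sigma_star3_ge s; lia. Qed.

(** The pattern of K_{1,4} is itself a closed weight for its own Sigma, and K_{1,3} embeds in it. *)
Lemma Sigma_star3_le_star4 s :
  (Sigma (graph_pattern (star 3) 2) s <= Sigma (graph_pattern (star 4) 2) s)%N.
Proof.
apply: (@closed_embed s _ _ (fun i j => graph_pattern (star 4) 2 [set i; j]%SET) _
  _ _ (widen_ord (leqnSn 4))).
  move=> p; have := leq_bigmax
    (F := fun f => mg_sum (blow_up (graph_pattern (star 4) 2) f) [set: 'I_s]%SET) (finfun p).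
  rewrite -(leq_pmul2l (isT : 0 < 2)%N) -(leq_add2r s) mg_sum_blow_up.
  apply: leq_trans; apply: eq_leq.
  by apply: eq_bigr => a _; apply: eq_bigr => b _; rewrite !ffunE.
by move=> i j; rewrite !star_patternE.
Qed.

Local Open Scope classical_set_scope.
Local Open Scope ring_scope.

Theorem theorem1p25 (R : realType) (s : nat) (hs : (2 <= s)%N) :
  [/\ forall q : nat,
        (2 * 'C(s, 2) <= q < Sigma (graph_pattern path4 2) s)%N ->
        exPi_root R s q n @[n --> \oo] --> (2 : R),
      forall q : nat,
        (Sigma (graph_pattern path4 2) s <= q
           < Sigma (graph_pattern (star 3) 2) s)%N ->
        exPi_root R s q n @[n --> \oo] --> 2 * (9 / 8 : R) `^ (1 / 6)
    & forall q : nat,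
        (Sigma (graph_pattern (star 3) 2) s <= q
           < Sigma (graph_pattern (star 4) 2) s)%N ->
        exPi_root R s q n @[n --> \oo] --> 2 * (27 / 16 : R) `^ (1 / 10)].
Proof.
have l2 : 0 < @ln R 2 by have /andP[] := ln2_itv R.
have l3 : 0 < @ln R 3 by rewrite ln_gt0 // ltr1n.
have lnE (a b : R) : 0 < a -> 0 < b -> ln (a / b) = ln a - ln b.
  by move=> a0 b0; rewrite lnM ?posrE ?invr_gt0 // lnV ?posrE.
have powE (a x : R) : 0 < a -> 2 * a `^ x = expR (ln 2 + x * ln a).
  by move=> a0; rewrite expRD lnK ?posrE // /powR gt_eqF.
split=> q /andP[ql qu].
- have q3 := leq_trans qu (Sigma_path4_le_star3 s).
  have q4 := leq_trans q3 (Sigma_star3_le_star4 s).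
  rewrite -[2]lnK ?posrE //; apply: exPi_root_cvg => // [n|].
    exists (fun=> 2%N); split.
    + move=> X Xs; apply: leq_trans ql; rewrite /mg_sum sum_nat_const mulnC leq_mul2l /=.
      by rewrite -Xs -cards_draws cardsE; apply/eq_leq/eq_card => A.
    + by rewrite /mg_prod prodn_cond_gt0.
    + rewrite ln_prod_nat // sumr_const mulr_natl.
      have -> // : #|[pred A : {set 'I_n} | #|A| == 2%N]| = 'C(n, 2).
      rewrite -[n in 'C(n, _)]card_ord -cardsT -cards_draws cardsE; apply: eq_card => A.
      by rewrite -!topredE /= finset.subsetT.
  apply: mg_prod_upper => //; first exact: ltW.
  move=> J W WC Wii W1 Wq; apply: le_trans (sum_ln_path4 R WC Wii W1 Wq q4 q3 qu) _.
  by rewrite lerDl mulr_ge0.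
- have q4 := leq_trans qu (Sigma_star3_le_star4 s).
  have -> : 2 * (9 / 8 : R) `^ (1 / 6) = expR ((3 * ln 2 + 2 * ln 3) / 6).
    rewrite powE ?divr_gt0 // lnE //; congr expR.
    have -> : 9 = 3 ^+ 2 :> R by ring.
    have -> : 8 = 2 ^+ 3 :> R by ring.
    by rewrite !lnXn // -[_ *+ 2]mulr_natl -[_ *+ 3]mulr_natl; field.
  apply: exPi_root_cvg => // [n|].
    (* A hexagon colour meets itself twice, three colours once and two colours not at all. *)
    have [||||f [fcol P0 le]] := @colour_graph_lower R hexagon _
      [:: 1; 2; 2; 2; 3; 3]%N ((3 * ln 2 + 2 * ln 3) / 6) n.
    + by apply/allP.
    + by [].
    + by [].
    + by rewrite !big_cons big_nil ln1 /=; field.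
    by exists (colour_graph f); split=> //; apply: colour_graph_hexagon ql fcol.
  apply: mg_prod_upper => //; first by rewrite divr_ge0 // addr_ge0 // mulr_ge0 // ltW.
  by move=> J W WC Wii W1 Wq; exact: (sum_ln_star3 R WC Wii W1 Wq q4 qu).
- have -> : 2 * (27 / 16 : R) `^ (1 / 10) = expR ((6 * ln 2 + 3 * ln 3) / 10).
    rewrite powE ?divr_gt0 // lnE //; congr expR.
    have -> : 27 = 3 ^+ 3 :> R by ring.
    have -> : 16 = 2 ^+ 4 :> R by ring.
    by rewrite !lnXn // -[_ *+ 3]mulr_natl -[_ *+ 4]mulr_natl; field.
  apply: exPi_root_cvg => // [n|].
    (* A Petersen colour meets itself twice, six colours once and three colours not at all. *)
    have [||||f [fcol P0 le]] := @colour_graph_lower R petersen _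
      [:: 1; 2; 2; 2; 2; 2; 2; 3; 3; 3]%N ((6 * ln 2 + 3 * ln 3) / 10) n.
    + by [].
    + by [].
    + by [].
    + by rewrite !big_cons big_nil ln1 /=; field.
    by exists (colour_graph f); split=> //; apply: colour_graph_petersen ql fcol.
  apply: mg_prod_upper => //; first by rewrite divr_ge0 // addr_ge0 // mulr_ge0 // ltW.
  by move=> J W WC Wii W1 Wq; exact: (sum_ln_star4 R WC Wii W1 Wq qu).
Qed.
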